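(* Let $x\in B_3$ be a 3-strand braid whose closure is a knot $\mathcal{K}$. Then $\mathcal{K}$ satisfies the HOMFLY--PT/Kauffman relation $$H(\mathcal{K};A,z)=\widetilde{KF}_{\rm even}(\mathcal{K};A,z)-\frac{z}{A-A^{-1}}\,\widetilde{KF}_{\rm odd}(\mathcal{K};A,z)$$ if and only if $$\widetilde{\chi_0}_{\rm odd}(A,q)=\frac{A-A^{-1}}{q-q^{-1}}\;\widetilde{\chi_0}_{\rm even}(A,q),$$ where $$\widetilde{KF}_{\rm even/odd}(\mathcal{K};A,z)=\tfrac12\bigl(KF(\mathcal{K};iA,iz)\pm KF(\mathcal{K};iA,-iz)\bigr),$$ $$\widetilde{\chi_0}_{\rm even/odd}(A,q)=\tfrac12\bigl(\chi_0(x;iA,iq)\pm\chi_0(x;iA,-iq)\bigr)$$ ($+$ for even, $-$ for odd).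
   Context: Braids: $\sigma_1,\sigma_2$ are the standard generators of $B_3$; $\sigma_i$ is a positive crossing when both strands are oriented in the same (braid) direction. The writhe $w$ of an oriented diagram is the sum of the signs of its crossings. HOMFLY--PT polynomial: $H(\mathcal{K};A,z)$ is the oriented link invariant with $H(\text{unknot})=1$ and $A\,H(L_+)-A^{-1}H(L_-)=z\,H(L_0)$, where $L_+,L_-,L_0$ differ at one place by a positive crossing, a negative crossing, and the oriented smoothing. Kauffman polynomial: $KF(\mathcal{K};A,z)=A^{-w}L(\mathcal{K};A,z)$, where $L$ is the regular isotopy invariant of unoriented diagrams with $L(\bigcirc)=1$, $L(D_+)+L(D_-)=z\,(L(D_0)+L(D_\infty))$ (where $D_\pm$ are diagrams differing only by switching one crossing and $D_0,D_\infty$ are the two smoothings of that crossing), and such that a curl of writhe $\pm1$ can be removed at the cost of a factor $A^{\pm1}$. The character $\chi_0$: $\chi_0(x;\alpha,\beta)=\operatorname{tr}\rho_0(x)$, where $\rho_0$ is the 3-dimensional representation of $B_3$ (coming from the Birman--Murakami--Wenzl algebra on 3 strands, Young diagram with one box) given, with $z=\beta+\beta^{-1}$, by $$\rho_0(\sigma_1)=\begin{pmatrix}\alpha^{-1}&0&z\\0&0&-1\\0&1&z\end{pmatrix},\qquad \rho_0(\sigma_2)=\begin{pmatrix}0&-1&0\\1&z&0\\0&\alpha^{-1}z&\alpha^{-1}\end{pmatrix}.$$ *)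

(* Defs.v *)
From Stdlib Require Import Relation_Operators.
From HB Require Import structures.
From mathcomp Require Import all_boot all_order all_algebra.
From mathcomp Require Import fraction.
From mathcomp Require Import mpoly.

Set Implicit Arguments.
Unset Strict Implicit.
Unset Printing Implicit Defensive.

Import GRing.Theory Num.Theory.
Local Open Scope ring_scope.

(* Link diagrams in Morse position: a diagram is a list of slices, read from
   bottom to top.  The slice (g, i) is the elementary tangle g placed to the
   right of i vertical strands, so that its strands are those in positions
   i, i + 1.  Every planar link diagram is of this form up to planar isotopy.
   [Cross true] is the crossing sigma of the braid groups, [Cross false] its
   inverse.
   Strands carry labels in T and [op : T -> T] is the label seen after turning
   back: T = bool, op = negb gives oriented diagrams (true = upwards), and
   T = unit, op = id gives unoriented ones.  [Cup o] creates strands labelled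
   o, op o. *)
Inductive tangle (T : Type) := Cup of T | Cap | Cross of bool.
Arguments Cap {T}.
Arguments Cross {T} _.

Definition slice (T : Type) := (tangle T * nat)%type.
Definition diagram (T : Type) := seq (slice T).

Definition odiagram := diagram bool.
Definition udiagram := diagram unit.

Definition ins (T : Type) (g : tangle T) : nat :=
  match g with Cup _ => 0 | _ => 2 end.
Definition outs (T : Type) (g : tangle T) : nat :=
  match g with Cap => 0 | _ => 2 end.

(* The labels of the strands above a slice, given those below it; None if the
   slice cannot be stacked there. *)
Definition step (T : eqType) (op : T -> T) (w : seq T) (s : slice T) :
    option (seq T) :=
  let: (g, i) := s in
  match g, drop i w with
  | Cup o, t => if (i <= size w)%N
                then Some (take i w ++ [:: o, op o & t]) else None
  | Cap, a :: b :: t => if b == op a then Some (take i w ++ t) else None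
  | Cross _, a :: b :: t => Some (take i w ++ [:: b, a & t])
  | _, _ => None
  end.

Definition labels (T : eqType) (op : T -> T) (D : diagram T) : option (seq T) :=
  foldl (fun ow s => obind (fun w => step op w s) ow) (Some [::]) D.

(* D is a diagram of a link: its slices fit, with no strand left at the top. *)
Definition is_link (T : eqType) (op : T -> T) (D : diagram T) : Prop :=
  labels op D = Some [::].

Notation olink D := (is_link negb D).
Notation ulink D := (is_link (@id unit) D).

Definition forget (D : odiagram) : udiagram :=
  [seq (match s.1 with Cup _ => Cup tt | Cap => Cap | Cross e => Cross e end,
        s.2) | s <- D].

(* Regular isotopy: planar isotopies (distant slices commute, zigzags are
   straightened, a strand slides across a maximum or a minimum) and the second
   and third Reidemeister moves. *)
Inductive regular_move (T : Type) (op : T -> T) :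
    diagram T -> diagram T -> Prop :=
| Move_far g h i j : (i <= j)%N ->
    regular_move op [:: (g, i); (h, j + outs g)%N] [:: (h, j + ins g)%N; (g, i)]
| Move_zigzag_l o i :
    regular_move op [:: (Cup o, i); (Cap, i.+1)] [::]
| Move_zigzag_r o i :
    regular_move op [:: (Cup o, i.+1); (Cap, i)] [::]
| Move_slide_cap e i :
    regular_move op [:: (Cross e, i); (Cap, i.+1)]
                    [:: (Cross (~~ e), i.+1); (Cap, i)]
| Move_slide_cup o e i :
    regular_move op [:: (Cup o, i); (Cross e, i.+1)]
                    [:: (Cup o, i.+1); (Cross (~~ e), i)]
| Move_R2 e i :
    regular_move op [:: (Cross e, i); (Cross (~~ e), i)] [::]
| Move_R3 e i :
    regular_move op [:: (Cross e, i); (Cross e, i.+1); (Cross e, i)]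
                    [:: (Cross e, i.+1); (Cross e, i); (Cross e, i.+1)].

(* [curl op s l r]: l is r with a curl added, the crossing of which has sign s
   (true = positive).  At a curl the two strands have opposite vertical
   directions, whence the negation. *)
Inductive curl (T : Type) (op : T -> T) :
    bool -> diagram T -> diagram T -> Prop :=
| Curl_cap e i : curl op (~~ e) [:: (Cross e, i); (Cap, i)] [:: (Cap, i)]
| Curl_cup o e i :
    curl op (~~ e) [:: (Cup o, i); (Cross e, i)] [:: (Cup (op o), i)].

(* A point (k, p) of D lies on the p-th strand just below slice k. *)
Definition on_diagram (D : odiagram) (P : nat * nat) : Prop :=
  (P.1 <= size D)%N /\
  exists2 w, labels negb (take P.1 D) = Some w & (P.2 < size w)%N.

Definition through (s : slice bool) (p : nat) : option nat :=
  let: (g, i) := s in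
  if (p < i)%N then Some p
  else if (i + ins g <= p)%N then Some (p - ins g + outs g)%N
  else match g with
       | Cross _ => Some (if p == i then i.+1 else i)
       | _ => None
       end.

Inductive joined (D : odiagram) : nat * nat -> nat * nat -> Prop :=
| Joined_through D1 s D2 p p' :
    D = D1 ++ s :: D2 -> through s p = Some p' ->
    joined D (size D1, p) ((size D1).+1, p')
| Joined_cup D1 o i D2 : D = D1 ++ (Cup o, i) :: D2 ->
    joined D ((size D1).+1, i) ((size D1).+1, i.+1)
| Joined_cap D1 i D2 : D = D1 ++ (Cap, i) :: D2 ->
    joined D (size D1, i) (size D1, i.+1).

(* A knot is a link with exactly one component. *)
Definition is_knot (D : odiagram) : Prop :=
  [/\ olink D, exists P, on_diagram D P
    & forall P Q, on_diagram D P -> on_diagram D Q ->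
        clos_refl_sym_trans _ (joined D) P Q].

(* Crossings keep their sign under reversal of both strands. *)
Definition crossing_sign (e a b : bool) : bool := e == (a == b).

Fixpoint writhe_from (w : seq bool) (D : odiagram) : int :=
  if D is s :: D' then
    (if s.1 is Cross e
     then if crossing_sign e (nth true w s.2) (nth true w s.2.+1) then 1 else -1
     else 0)
    + (if step negb w s is Some w' then writhe_from w' D' else 0)
  else 0.

Definition writhe (D : odiagram) : int := writhe_from [::] D.

(* The oriented smoothing of a crossing in position i whose incoming (lower)
   strands have directions a and b. *)
Definition oriented_smoothing (a b : bool) (i : nat) : odiagram :=
  if a == b then [::] else [:: (Cap, i); (Cup b, i)].

(* The field C(X, Y) of rational functions; Laurent polynomials live in it. *)
Notation ratfun C := {fraction {mpoly C[2]}}.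

Section RationalFunctions.
Variable C : numClosedFieldType.

Definition ratX : ratfun C := tofrac 'X_(0 : 'I_2).
Definition ratY : ratfun C := tofrac 'X_(1 : 'I_2).
Definition ratC (c : C) : ratfun C := tofrac c%:MP.

(* The value f(a, b) of f = f(X, Y). *)
Definition rateval (f a b : ratfun C) : ratfun C :=
  let ev := mmap ratC (fun k : 'I_2 => if k == 0 then a else b) in
  ev \n_(repr f) / ev \d_(repr f).

End RationalFunctions.

Section Invariants.
Variable C : numClosedFieldType.
Local Notation K := (ratfun C).

(* Both polynomials are elements of C(A, z), where A = X and z = Y. *)
Local Notation A := (ratX C).
Local Notation z := (ratY C).
Local Notation im := (ratC ('i : C)).

Record is_homflypt (H : odiagram -> K) : Prop := IsHomflypt {
  homflypt_unknot : forall o, H [:: (Cup o, 0%N); (Cap, 0%N)] = 1;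
  homflypt_regular : forall u l r v, regular_move negb l r ->
    olink (u ++ l ++ v) -> olink (u ++ r ++ v) ->
    H (u ++ l ++ v) = H (u ++ r ++ v);
  homflypt_curl : forall u l r v s, curl negb s l r ->
    olink (u ++ l ++ v) -> olink (u ++ r ++ v) ->
    H (u ++ l ++ v) = H (u ++ r ++ v);
  homflypt_skein : forall u v i w e,
    olink (u ++ (Cross e, i) :: v) -> labels negb u = Some w ->
    let a := nth true w i in
    let b := nth true w i.+1 in
    crossing_sign e a b ->
    A * H (u ++ (Cross e, i) :: v) - A^-1 * H (u ++ (Cross (~~ e), i) :: v)
      = z * H (u ++ oriented_smoothing a b i ++ v)
}.

(* The regular isotopy invariant L. *)
Record is_kauffman (L : udiagram -> K) : Prop := IsKauffman {
  kauffman_unknot : L [:: (Cup tt, 0%N); (Cap, 0%N)] = 1;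
  kauffman_regular : forall u l r v, regular_move id l r ->
    ulink (u ++ l ++ v) -> ulink (u ++ r ++ v) ->
    L (u ++ l ++ v) = L (u ++ r ++ v);
  kauffman_curl : forall u l r v s, curl id s l r ->
    ulink (u ++ l ++ v) -> ulink (u ++ r ++ v) ->
    L (u ++ l ++ v) = (if s then A else A^-1) * L (u ++ r ++ v);
  kauffman_skein : forall u v i,
    ulink (u ++ (Cross true, i) :: v) ->
    L (u ++ (Cross true, i) :: v) + L (u ++ (Cross false, i) :: v)
      = z * (L (u ++ v) + L (u ++ [:: (Cap, i); (Cup tt, i)] ++ v))
}.

Definition KF (L : udiagram -> K) (D : odiagram) : K :=
  A ^ (- writhe D) * L (forget D).

Definition KF_even (L : udiagram -> K) (D : odiagram) : K :=
  2^-1 * (rateval (KF L D) (im * A) (im * z)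
          + rateval (KF L D) (im * A) (- (im * z))).
Definition KF_odd (L : udiagram -> K) (D : odiagram) : K :=
  2^-1 * (rateval (KF L D) (im * A) (im * z)
          - rateval (KF L D) (im * A) (- (im * z))).

End Invariants.

(* A braid in B_3 is given by a word: (k, true) is the k-th standard generator
   (counting from 0) and (k, false) its inverse. *)
Definition braid3 := seq ('I_2 * bool).

(* All three strands of the braid are oriented upwards. *)
Definition braid_closure (x : braid3) : odiagram :=
  [:: (Cup true, 0%N); (Cup true, 1%N); (Cup true, 2%N)]
  ++ [seq (Cross s.2, nat_of_ord s.1) | s <- x]
  ++ [:: (Cap, 2%N); (Cap, 1%N); (Cap, 0%N)].

Section Character.
Variable F : fieldType.

Definition mx3 (rows : seq (seq F)) : 'M[F]_3 :=
  \matrix_(i < 3, j < 3) nth 0 (nth [::] rows i) j.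

Definition rho0_gen (alpha beta : F) (k : 'I_2) : 'M[F]_3 :=
  let z := beta + beta^-1 in
  if k == 0 then
    mx3 [:: [:: alpha^-1; 0; z ];
            [:: 0       ; 0; -1];
            [:: 0       ; 1; z ]]
  else
    mx3 [:: [:: 0; -1          ; 0       ];
            [:: 1; z           ; 0       ];
            [:: 0; alpha^-1 * z; alpha^-1]].

Definition rho0 (alpha beta : F) (x : braid3) : 'M[F]_3 :=
  \prod_(s <- x)
     (if s.2 then rho0_gen alpha beta s.1 else (rho0_gen alpha beta s.1)^-1).

Definition chi0 (alpha beta : F) (x : braid3) : F := \tr (rho0 alpha beta x).

End Character.

Section TwistedCharacter.
Variable C : numClosedFieldType.

(* The characters are compared in C(A, q), where A = X and q = Y. *)
Local Notation A := (ratX C).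
Local Notation q := (ratY C).
Local Notation im := (ratC ('i : C)).

Definition chi0_even (x : braid3) : ratfun C :=
  2^-1 * (chi0 (im * A) (im * q) x + chi0 (im * A) (- (im * q)) x).
Definition chi0_odd (x : braid3) : ratfun C :=
  2^-1 * (chi0 (im * A) (im * q) x - chi0 (im * A) (- (im * q)) x).

End TwistedCharacter.

(* Main.v *)
(* On 3-braids the Kauffman polynomial L of the closure is a trace on the BMW
   algebra.  Its ideal generated by the hooks e_i = cap-cup acts faithfully on
   the three-dimensional left ideal spanned by e_1, g_2 e_1, e_2 e_1, and this
   action is rho_0; comparing a few small diagrams shows that L and the
   character chi_0 agree on that ideal.  So L = T + chi_0, where T factors
   through the Hecke algebra.  After the substitution A -> iA, z -> +-iz and
   renormalisation by the writhe, T satisfies the skein relation of the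
   HOMFLY-PT polynomial, and a conjugation invariant function with this skein
   relation is determined by its values on 1, g_2 and g_1 g_2.  Checking these
   three values expresses H by the even and odd parts of T exactly as in the
   HOMFLY-PT/Kauffman relation, for every braid for which i^w = (-i)^w; for a
   knot the writhe w is even.  What remains of the relation is the relation
   between the even and odd parts of chi_0, up to the injective change of
   variables z = q - 1/q. *)

From HB Require Import structures.
From Stdlib Require Import Relation_Operators.
Require Import Defs.
From mathcomp Require Import all_boot all_order all_algebra.
From mathcomp Require Import fraction mpoly.
From mathcomp Require Import zify ring.
Import GRing.Theory Num.Theory.
Local Open Scope ring_scope.

Set Implicit Arguments.
Unset Strict Implicit.

(** * Labels and regular moves *)

Lemma ord2P (i : 'I_2) : {i = 0} + {i = 1}.
Proof. by case: i => [[|[|i]] hi] //; [left|right]; apply: val_inj. Qed.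

Section Run.
Variables (T : eqType) (op : T -> T).

Definition run (w : seq T) (D : diagram T) : option (seq T) :=
  foldl (fun ow s => obind (fun w => step op w s) ow) (Some w) D.

Lemma run_none (D : diagram T) :
  foldl (fun ow s => obind (fun w => step op w s) ow) None D = None.
Proof. by elim: D. Qed.

Lemma run_cat w D1 D2 : run w (D1 ++ D2) = obind (run ^~ D2) (run w D1).
Proof.
rewrite /run foldl_cat; case: (foldl _ (Some w) D1) => //=.
exact: run_none.
Qed.

Lemma run_cons w s D : run w (s :: D) = obind (run ^~ D) (step op w s).
Proof. exact: (run_cat w [:: s] D). Qed.

Lemma run_cat_some w1 w2 w3 D1 D2 :
  run w1 D1 = Some w2 -> run w2 D2 = Some w3 -> run w1 (D1 ++ D2) = Some w3.
Proof. by move=> h1 h2; rewrite run_cat h1. Qed.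

(** A slice touches only positions below [size w], so strands added on the right are carried along.
    The size facts locate it when it is exchanged with a crossing further right. *)
Lemma step_cat w w' s r : step op w s = Some w' ->
  [/\ step op (w ++ r) s = Some (w' ++ r), (s.2 + ins s.1 <= size w)%N
    & (size w' + ins s.1 = size w + outs s.1)%N].
Proof.
case: s => g i /=; case: (leqP i (size w)) => hi; last first.
  by rewrite drop_oversize ?(ltnW hi) //=; case: g.
have [dw tw] : drop i (w ++ r) = drop i w ++ r /\ take i (w ++ r) = take i w.
  split; last by rewrite takel_cat.
  rewrite drop_cat; case: ltnP => // h.
  have -> : i = size w by apply/eqP; rewrite eqn_leq hi.
  by rewrite subnn drop0 drop_size.
have : (size (take i w) + size (drop i w) = size w)%N by rewrite -size_cat cat_take_drop.
rewrite dw tw; case: g => [o||e] /=.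

- rewrite size_cat (leq_trans hi (leq_addr _ _)) => hs [<-].
  by rewrite -catA !size_cat /=; split => //; lia.
- case: (drop i w) => [|a [|b t]] //= hs; case: ifP => // _ [<-].
  by rewrite catA !size_cat; split => //; move: (size_takel hi); lia.
- case: (drop i w) => [|a [|b t]] //= hs [<-].
  by rewrite -!catA !size_cat; split => //=; move: (size_takel hi) hs => /=; lia.
Qed.

Lemma run_far w w' r D : run w D = Some w' -> run (w ++ r) D = Some (w' ++ r).
Proof.
elim: D w => [|s D IH] w; first by case=> ->.
rewrite !run_cons; case E: (step op w s) => [w1|] //= /IH.
by have [-> _ _] := step_cat r E.
Qed.

End Run.

(** H is the case [op = negb], [c = 1] and L the case [op = id], [c = A], so the isotopies of braid
    closures are carried out once for both. *)
Record regular_invariant (T : eqType) (op : T -> T) (K : fieldType) (c : K)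
    (f : diagram T -> K) : Prop := RegularInvariant {
  regular_invariance : forall u l r v, regular_move op l r ->
    is_link op (u ++ l ++ v) -> is_link op (u ++ r ++ v) ->
    f (u ++ l ++ v) = f (u ++ r ++ v);
  curl_factor : forall u l r v s, curl op s l r ->
    is_link op (u ++ l ++ v) -> is_link op (u ++ r ++ v) ->
    f (u ++ l ++ v) = (if s then c else c^-1) * f (u ++ r ++ v)
}.

Definition closure3 (T : Type) (o : T) (D : diagram T) : diagram T :=
  [:: (Cup o, 0%N); (Cup o, 1%N); (Cup o, 2%N)]
  ++ D ++ [:: (Cap, 2%N); (Cap, 1%N); (Cap, 0%N)].

Definition closure2 (T : Type) (o : T) (D : diagram T) : diagram T :=
  [:: (Cup o, 0%N); (Cup o, 1%N)] ++ D ++ [:: (Cap, 1%N); (Cap, 0%N)].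

Definition hook (i : nat) : udiagram := [:: (Cap, i); (Cup tt, i)].

(** * Moves applied inside a diagram *)

Section Isotopy.
Variables (T : eqType) (op : T -> T) (K : fieldType) (c : K).
Variable f : diagram T -> K.
Hypothesis hf : regular_invariant op c f.

(** [w] and [w'] are the labels at the bottom and top of the gap between [u] and [v]; that a filling
    gives a link is then a computation on the filling alone. *)
Definition in_context (u v : diagram T) (w w' : seq T) : Prop :=
  labels op u = Some w /\ run op w' v = Some [::].

Lemma in_context_link u v w w' D :
  in_context u v w w' -> run op w D = Some w' -> is_link op (u ++ D ++ v).
Proof.
by move=> [hu hv] hD; apply: (run_cat_some hu); apply: run_cat_some hD hv.
Qed.

Lemma splice n m (D : diagram T) :
  take n D ++ take m (drop n D) ++ drop m (drop n D) = D.
Proof. by rewrite !cat_take_drop. Qed.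

Lemma regular_at n (l r : diagram T) (u v : diagram T) w w' D :
    in_context u v w w' -> regular_move op l r \/ regular_move op r l ->
    take (size l) (drop n D) = l -> run op w D = Some w' ->
    run op w (take n D ++ r ++ drop (size l) (drop n D)) = Some w' ->
  f (u ++ D ++ v) = f (u ++ (take n D ++ r ++ drop (size l) (drop n D)) ++ v).
Proof.
move=> huv hlr hl hD hD'.
have link1 := in_context_link huv hD; have link2 := in_context_link huv hD'.
have E : u ++ D ++ v = (u ++ take n D) ++ l ++ drop (size l) (drop n D) ++ v.
  by rewrite -{1}(splice n (size l) D) hl -!catA.
rewrite -!catA (catA u) in link2 *; rewrite E in link1 *.
by case: hlr => hlr; [|symmetry]; apply: (regular_invariance hf hlr).
Qed.

Lemma curl_at n s (l r : diagram T) (u v : diagram T) w w' D :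
    in_context u v w w' -> curl op s l r ->
    take (size l) (drop n D) = l -> run op w D = Some w' ->
    run op w (take n D ++ r ++ drop (size l) (drop n D)) = Some w' ->
  f (u ++ D ++ v) = (if s then c else c^-1) *
    f (u ++ (take n D ++ r ++ drop (size l) (drop n D)) ++ v).
Proof.
move=> huv hlr hl hD hD'.
have link1 := in_context_link huv hD; have link2 := in_context_link huv hD'.
have := curl_factor hf hlr (u := u ++ take n D) (v := drop (size l) (drop n D) ++ v).
rewrite -{1 4}hl -!catA (catA (take (size l) _)) (catA (take n D)) splice.
apply => //; by move: link2; rewrite -!catA.
Qed.


Lemma step_cross_right w wr wr' e k :
  step op wr (Cross e, k) = Some wr' ->
  step op (w ++ wr) (Cross e, (size w + k)%N) = Some (w ++ wr').
Proof.
rewrite /= addnC -drop_drop drop_size_cat // take_cat ltnNge leq_addl /= addnK.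
by case: (drop k wr) => [|a [|b t]] //= [<-]; rewrite catA.
Qed.

(** The slices of [D] are exchanged one by one with the crossing by [Move_far]. They act on the left
    strands only, so the position of the crossing shifts by the change in their number. *)
Lemma cross_far u v w w' wr wr' e k (D : diagram T) :
    labels op u = Some (w ++ wr) -> run op w D = Some w' ->
    step op wr (Cross e, k) = Some wr' -> run op (w' ++ wr') v = Some [::] ->
  f (u ++ D ++ (Cross e, (size w' + k)%N) :: v)
    = f (u ++ (Cross e, (size w + k)%N) :: D ++ v).
Proof.
move=> + + hwr hv; elim: D u w => [|[g i] D IH] u w hu; first by case=> ->.
rewrite run_cons; case E: (step op w (g, i)) => [w1|] //= hD.
have [hstep hi hsz] := step_cat wr E.
have [hstep' _ _] := step_cat wr' E.
have hu1 : labels op (rcons u (g, i)) = Some (w1 ++ wr).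
  by rewrite -cats1; apply: run_cat_some hu _; rewrite run_cons hstep.
have := IH _ _ hu1 hD; rewrite cat_rcons => ->; rewrite cat_rcons.
move: hi hsz => /= hi hsz.
(* The slice lies wholly to the left of the crossing, so this natural subtraction is exact. *)
have hj : (i <= size w + k - ins g)%N by lia.
have := Move_far op g (Cross e) hj.
have -> : (size w + k - ins g + outs g = size w1 + k)%N by lia.
have -> : (size w + k - ins g + ins g = size w + k)%N by lia.
have hlast : run op (w1 ++ wr') (D ++ v) = Some [::].
  exact: run_cat_some (run_far _ hD) hv.
move/(regular_invariance hf (u := u) (v := D ++ v)) => /=; apply.
- apply: (run_cat_some hu).
  by rewrite run_cons hstep /= run_cons (step_cross_right _ hwr).
- apply: (run_cat_some hu).
  by rewrite run_cons (step_cross_right _ hwr) /= run_cons hstep'.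
Qed.

Definition isotopy_at n l r u v w w' D h (hlr : regular_move op l r) :=
  @regular_at n l r u v w w' D h (or_introl hlr).

Definition isotopy_back_at n l r u v w w' D h (hlr : regular_move op r l) :=
  @regular_at n l r u v w w' D h (or_intror hlr).

End Isotopy.

Ltac check_labels :=
  cbv [run take drop cat size addn Nat.add ins outs closure2 closure3 hook]; rewrite /=;
  by [ | do ?[rewrite ?eqxx /=]
       | match goal with opK : involutive _ |- _ => do ?[rewrite ?opK ?eqxx /=] end ].
Ltac splice_labels := [> match goal with |- context [take ?n ?D1 ++ ?D2] =>
    let D := eval cbv [take drop cat size addn Nat.add ins outs
      closure2 closure3 hook] in (take n D1 ++ D2) in
    change (take n D1 ++ D2) with D end
  | reflexivity | check_labels | check_labels].
(* [iso h n m] applies the move m to the slices of the diagram from the n-th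
   one on, h : in_context _ _ _ _ _ telling where the diagram is; [iso_back]
   applies the inverse of m, and [uncurl] removes a curl. *)
Tactic Notation "iso" constr(h) constr(n) uconstr(m) :=
  match goal with hf : regular_invariant _ _ _ |- _ =>
    rewrite (isotopy_at (n := n) hf h m); splice_labels end.
Tactic Notation "iso_back" constr(h) constr(n) uconstr(m) :=
  match goal with hf : regular_invariant _ _ _ |- _ =>
    rewrite (isotopy_back_at (n := n) hf h m); splice_labels end.
Tactic Notation "uncurl" constr(h) constr(n) uconstr(m) :=
  match goal with hf : regular_invariant _ _ _ |- _ =>
    rewrite (curl_at (n := n) hf h m); splice_labels end.

(** * Closures of braids: conjugation and stabilisation *)

Definition braid_slices (T : Type) (x : braid3) : diagram T :=
  [seq (Cross s.2, nat_of_ord s.1) | s <- x].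

Lemma braid_slices_cat T x y :
  braid_slices T (x ++ y) = braid_slices T x ++ braid_slices T y.
Proof. exact: map_cat. Qed.

Lemma run_braid_slices (T : eqType) (op : T -> T) o x :
  run op [:: o; o; o] (braid_slices T x) = Some [:: o; o; o].
Proof.
elim: x => [|[[k hk] e] x IH] //; rewrite /braid_slices map_cons run_cons /=.
by case: k hk => [|[]] //= _; exact: IH.
Qed.

(* Conjugation invariance is left out because left translates, which
   hecke_functional_eq0 uses, do not keep it. *)
Record braid_function (R : Type) (F : braid3 -> R) : Prop := BraidFunction {
  braid_R2 : forall x y k e, F (x ++ [:: (k, e); (k, ~~ e)] ++ y) = F (x ++ y);
  braid_R3 : forall x y k l e, F (x ++ [:: (k, e); (l, e); (k, e)] ++ y)
    = F (x ++ [:: (l, e); (k, e); (l, e)] ++ y)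
}.

Section Closure.
Variables (T : eqType) (op : T -> T) (K : fieldType) (c : K).
Variable f : diagram T -> K.
Hypothesis opK : involutive op.
Hypothesis hf : regular_invariant op c f.

Let w6 (o : T) := [:: o; o; o; op o; op o; op o].

(** Each slide across a maximum moves the crossing one place to the right and negates it; two slides
    restore the exponent. *)
Lemma slide_over_top_1 o u v e : in_context op u v (w6 o) [::] ->
  f (u ++ [:: (Cross e, 1%N); (Cap, 2%N); (Cap, 1%N); (Cap, 0%N)] ++ v)
  = f (u ++ [:: (Cross e, 3%N); (Cap, 2%N); (Cap, 1%N); (Cap, 0%N)] ++ v).
Proof.
move=> h.
iso h 0%N (Move_slide_cap op e 1).
iso h 1%N (Move_far op Cap Cap (leqnn 1)).
iso h 0%N (Move_slide_cap op (~~ e) 2); by rewrite negbK.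
Qed.

Lemma slide_over_top_0 o u v e : in_context op u v (w6 o) [::] ->
  f (u ++ [:: (Cross e, 0%N); (Cap, 2%N); (Cap, 1%N); (Cap, 0%N)] ++ v)
  = f (u ++ [:: (Cross e, 4%N); (Cap, 2%N); (Cap, 1%N); (Cap, 0%N)] ++ v).
Proof.
move=> h.
iso h 0%N (Move_far op (Cross e) Cap (leqnn 0)).
iso h 1%N (Move_slide_cap op e 0).
iso h 2%N (Move_far op Cap Cap (leqnn 0)).
iso h 1%N (Move_slide_cap op (~~ e) 1); rewrite negbK.
by iso h 0%N (Move_far op Cap (Cross e) (leqnn 2)).
Qed.

Lemma slide_under_bottom_1 o u v e : in_context op u v [::] (w6 o) ->
  f (u ++ [:: (Cup o, 0%N); (Cup o, 1%N); (Cup o, 2%N); (Cross e, 3%N)] ++ v)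
  = f (u ++ [:: (Cup o, 0%N); (Cup o, 1%N); (Cup o, 2%N); (Cross e, 1%N)] ++ v).
Proof.
move=> h.
iso h 2%N (Move_slide_cup op o e 2).
iso h 1%N (Move_far op (Cup o) (Cup o) (leqnn 1)).
by iso h 2%N (Move_slide_cup op o (~~ e) 1); rewrite negbK.
Qed.

Lemma slide_under_bottom_0 o u v e : in_context op u v [::] (w6 o) ->
  f (u ++ [:: (Cup o, 0%N); (Cup o, 1%N); (Cup o, 2%N); (Cross e, 4%N)] ++ v)
  = f (u ++ [:: (Cup o, 0%N); (Cup o, 1%N); (Cup o, 2%N); (Cross e, 0%N)] ++ v).
Proof.
move=> h.
iso h 2%N (Move_far op (Cup o) (Cross e) (leqnn 2)).
iso h 1%N (Move_slide_cup op o e 1).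
iso h 0%N (Move_far op (Cup o) (Cup o) (leqnn 0)).
iso h 1%N (Move_slide_cup op o (~~ e) 0); rewrite negbK.
by iso h 2%N (Move_far op (Cross e) (Cup o) (leqnn 0)).
Qed.

(** The top crossing goes over the nested maxima to position [4 - k], on the closing strands,
    travels along them past [D], and returns under the nested minima. *)
Lemma closure3_cyclic o e k D : run op [:: o; o; o] D = Some [:: o; o; o] ->
  (k < 2)%N ->
  f (closure3 o (D ++ [:: (Cross e, k)])) = f (closure3 o ((Cross e, k) :: D)).
Proof.
move=> hD hk; set cups := [:: (Cup o, 0%N); (Cup o, 1%N); (Cup o, 2%N)].
set caps := [:: (@Cap T, 2%N); (Cap, 1%N); (Cap, 0%N)].
pose w3 := [:: op o; op o; op o].
have hcaps : run op ([:: o; o; o] ++ w3) caps = Some [::] by check_labels.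
have hD6 := run_far w3 hD.
have hcD : labels op (cups ++ D) = Some (w6 o) by apply: run_cat_some hD6.
have htop : in_context op (cups ++ D) [::] (w6 o) [::] by split.
have hbot : in_context op [::] (D ++ caps) [::] (w6 o).
  by split => //; apply: run_cat_some hD6 hcaps.
rewrite /closure3 -/cups -/caps.
have -> : cups ++ (D ++ [:: (Cross e, k)]) ++ caps
    = (cups ++ D) ++ ((Cross e, k) :: caps) ++ [::] by rewrite cats0 -!catA.
have far j : (j < 2)%N -> f (cups ++ D ++ (Cross e, (3 + j)%N) :: caps)
    = f (cups ++ (Cross e, (3 + j)%N) :: D ++ caps).
  move=> hj.
  apply: (cross_far hf (w := [:: o; o; o]) (w' := [:: o; o; o])
    (wr := w3) (wr' := w3)) => //.
  by case: j hj => [|[]].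
case: k hk => [|[]] // _.
  rewrite (slide_over_top_0 _ htop) cats0 -catA (far 1%N) //.
  exact: slide_under_bottom_0 hbot.
rewrite (slide_over_top_1 _ htop) cats0 -catA (far 0%N) //.
exact: slide_under_bottom_1 hbot.
Qed.

Let h0 : in_context op [::] [::] [::] [::]. Proof. by []. Qed.

(** Slid across the innermost minimum, the crossing becomes a curl at the innermost maximum; its
    removal leaves a zigzag. *)
Lemma markov_closure3 o e :
  f (closure3 o [:: (Cross e, 1%N)])
    = (if e then c else c^-1) * f (closure2 o [::]).
Proof.
rewrite -[closure3 _ _]cats0 -[_ ++ [::]]cat0s.
case: e.
  iso_back h0 2%N (Move_slide_cup op o false 1).
  uncurl h0 3%N (Curl_cap op false 2).
  by iso h0 2%N (Move_zigzag_l op o 1).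
iso_back h0 2%N (Move_slide_cup op o true 1).
uncurl h0 3%N (Curl_cap op true 2).
by iso h0 2%N (Move_zigzag_l op o 1).
Qed.

(** The first crossing avoids the innermost minimum and moves below it; the second is then removed
    as in [markov_closure3]. *)
Lemma markov_closure3_mul o :
  f (closure3 o [:: (Cross true, 0%N); (Cross true, 1%N)])
    = c * f (closure2 o [:: (Cross true, 0%N)]).
Proof.
rewrite -[closure3 _ _]cats0 -[_ ++ [::]]cat0s.
iso_back h0 2%N (Move_far op (Cross true) (Cup o) (leqnn 0)).
iso_back h0 3%N (Move_slide_cup op o false 1).
uncurl h0 4%N (Curl_cap op false 2).
by iso h0 3%N (Move_zigzag_l op o 1).
Qed.

Lemma markov_closure2 o e :
  f (closure2 o [:: (Cross e, 0%N)])
    = (if e then c else c^-1) * f [:: (Cup o, 0%N); (Cap, 0%N)].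
Proof.
rewrite -[closure2 _ _]cats0 -[_ ++ [::]]cat0s.
case: e.
  iso_back h0 1%N (Move_slide_cup op o false 0).
  uncurl h0 2%N (Curl_cap op false 1).
  by iso h0 1%N (Move_zigzag_l op o 0).
iso_back h0 1%N (Move_slide_cup op o true 0).
uncurl h0 2%N (Curl_cap op true 1).
by iso h0 1%N (Move_zigzag_l op o 0).
Qed.

Lemma labels_cups_braid o x :
  labels op ([:: (Cup o, 0%N); (Cup o, 1%N); (Cup o, 2%N)] ++ braid_slices T x)
    = Some (w6 o).
Proof.
apply: (@run_cat_some _ op [::] (w6 o)); first by [].
exact: (run_far [:: op o; op o; op o] (run_braid_slices op o x)).
Qed.

Lemma labels_closure3 o x D :
  labels op (closure3 o (braid_slices T x ++ D))
    = run op (w6 o) (D ++ [:: (Cap, 2%N); (Cap, 1%N); (Cap, 0%N)]).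
Proof.
rewrite /closure3 -catA (catA _ (braid_slices T x)).
rewrite -[LHS]/(run op [::] _) (run_cat op [::]).
by rewrite (labels_cups_braid o x : run _ _ _ = _).
Qed.

Lemma link_closure3 o D : run op [:: o; o; o] D = Some [:: o; o; o] ->
  is_link op (closure3 o D).
Proof.
move=> /(run_far [:: op o; op o; op o]) hD.
apply: (@run_cat_some _ op [::] (w6 o)); first by [].
by apply: run_cat_some hD _; check_labels.
Qed.

Lemma closure3_R2 o x k e D : is_link op (closure3 o (braid_slices T x ++ D)) ->
  f (closure3 o (braid_slices T (x ++ [:: (k, e); (k, ~~ e)]) ++ D))
    = f (closure3 o (braid_slices T x ++ D)).
Proof.
move=> hlink.
have hlink2 : is_link op
    (closure3 o (braid_slices T (x ++ [:: (k, e); (k, ~~ e)]) ++ D)).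
  by rewrite /is_link labels_closure3 -(labels_closure3 o x).
have := regular_invariance hf (Move_R2 op e k)
  (u := [:: (Cup o, 0%N); (Cup o, 1%N); (Cup o, 2%N)] ++ braid_slices T x)
  (v := D ++ [:: (Cap, 2%N); (Cap, 1%N); (Cap, 0%N)]).
by move: hlink hlink2; rewrite /closure3 braid_slices_cat -!catA /= => h1 h2; apply.
Qed.

Lemma closure3_R3 o x k l e D : is_link op (closure3 o (braid_slices T x ++ D)) ->
  f (closure3 o (braid_slices T (x ++ [:: (k, e); (l, e); (k, e)]) ++ D))
    = f (closure3 o (braid_slices T (x ++ [:: (l, e); (k, e); (l, e)]) ++ D)).
Proof.
move=> hlink.
have hlink2 y : is_link op (closure3 o (braid_slices T y ++ D)).
  by rewrite /is_link labels_closure3 -(labels_closure3 o x).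
have R3 : f (closure3 o (braid_slices T (x ++ [:: (0, e); (1, e); (0, e)]) ++ D))
    = f (closure3 o (braid_slices T (x ++ [:: (1, e); (0, e); (1, e)]) ++ D)).
  have := regular_invariance hf (Move_R3 op e 0)
    (u := [:: (Cup o, 0%N); (Cup o, 1%N); (Cup o, 2%N)] ++ braid_slices T x)
    (v := D ++ [:: (Cap, 2%N); (Cap, 1%N); (Cap, 0%N)]).
  move: (hlink2 (x ++ [:: (0, e); (1, e); (0, e)])).
  move: (hlink2 (x ++ [:: (1, e); (0, e); (1, e)])).
  by rewrite /closure3 !braid_slices_cat -!catA /= => h1 h2; apply.
by case: (ord2P k) => ->; case: (ord2P l) => -> //.
Qed.

Lemma braid_function_closure3 o :
  braid_function (fun x => f (closure3 o (braid_slices T x))).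
Proof.
have link x y : is_link op (closure3 o (braid_slices T x ++ braid_slices T y)).
  by rewrite -braid_slices_cat; apply: link_closure3; apply: run_braid_slices.
split=> x y k => [e|l e].
  by rewrite catA !(braid_slices_cat _ _ y) closure3_R2.
by rewrite !catA !(braid_slices_cat _ _ y) closure3_R3.
Qed.

Lemma closure3_conj o x s :
  f (closure3 o (braid_slices T (x ++ [:: s])))
    = f (closure3 o (braid_slices T (s :: x))).
Proof.
by case: s => k e; rewrite braid_slices_cat closure3_cyclic // run_braid_slices.
Qed.

End Closure.

(** * The representation rho_0 *)

Lemma mxtrace_mulrC (F : fieldType) n (A B : 'M[F]_n.+1) : \tr (A * B) = \tr (B * A).
Proof. exact: mxtrace_mulC. Qed.

Section BMWRepresentation.
Variables (F : fieldType) (a z : F).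
Hypothesis a_neq0 : a != 0.

(** The matrices of [rho0_gen] with [z] free in place of [beta + beta^-1]: the comparison takes
    place over C(A, z), and [beta] returns only with the final change of variables. *)
Definition bmw_gen (k : 'I_2) : 'M[F]_3 :=
  if k == 0 then
    mx3 [:: [:: a^-1; 0; z ];
            [:: 0   ; 0; -1];
            [:: 0   ; 1; z ]]
  else
    mx3 [:: [:: 0; -1      ; 0   ];
            [:: 1; z       ; 0   ];
            [:: 0; a^-1 * z; a^-1]].

Definition bmw_gen_inv (k : 'I_2) : 'M[F]_3 :=
  if k == 0 then
    mx3 [:: [:: a; a * z; 0];
            [:: 0; z    ; 1];
            [:: 0; -1   ; 0]]
  else
    mx3 [:: [:: z ; 1; 0];
            [:: -1; 0; 0];
            [:: z ; 0; a]].

Local Ltac mx3_eq := apply/matrixP;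
  do 2![case=> [[|[|[|?]]] ?] //=]; rewrite !(mxE, big_ord_recl, big_ord0) /=.

Lemma bmw_gen_mulV k : bmw_gen k * bmw_gen_inv k = 1.
Proof.
rewrite /bmw_gen /bmw_gen_inv; case: ifP => _; mx3_eq; by field; rewrite ?a_neq0 ?z_neq0.
Qed.

Lemma bmw_gen_unit k : bmw_gen k \is a GRing.unit.
Proof. by have [] := mulmx1_unit (bmw_gen_mulV k). Qed.

Lemma bmw_genV k : (bmw_gen k)^-1 = bmw_gen_inv k.
Proof. by rewrite -[RHS](mulKr (bmw_gen_unit k)) bmw_gen_mulV mulr1. Qed.

Lemma bmw_gen_braid (k l : 'I_2) :
  bmw_gen k * bmw_gen l * bmw_gen k = bmw_gen l * bmw_gen k * bmw_gen l.
Proof.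
suff braid01 :
    bmw_gen 0 * bmw_gen 1 * bmw_gen 0 = bmw_gen 1 * bmw_gen 0 * bmw_gen 1.
  by case: (ord2P k) => ->; case: (ord2P l) => ->.
have -> : bmw_gen 0 * bmw_gen 1 = mx3 [:: [:: 0; a^-1 * z ^+ 2 - a^-1; a^-1 * z];
    [:: 0; - (a^-1 * z); - a^-1]; [:: 1; z + a^-1 * z ^+ 2; a^-1 * z]].
  by rewrite /bmw_gen /=; mx3_eq; ring.
have -> : bmw_gen 1 * bmw_gen 0 =
    mx3 [:: [:: 0; 0; 1]; [:: a^-1; 0; 0]; [:: 0; a^-1; 0]].
  by rewrite /bmw_gen /=; mx3_eq; ring.
by rewrite /bmw_gen /=; mx3_eq; ring.
Qed.

Definition bmw_letter (s : 'I_2 * bool) : 'M[F]_3 :=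
  if s.2 then bmw_gen s.1 else (bmw_gen s.1)^-1.

Definition bmw (x : braid3) : 'M[F]_3 := \prod_(s <- x) bmw_letter s.

Lemma bmw_cat x y : bmw (x ++ y) = bmw x * bmw y.
Proof. exact: big_cat. Qed.

Lemma bmw_cons s x : bmw (s :: x) = bmw_letter s * bmw x.
Proof. exact: big_cons. Qed.

Lemma bmw_nil : bmw [::] = 1.
Proof. exact: big_nil. Qed.

Lemma bmw_letterK k e : bmw_letter (k, e) * bmw_letter (k, ~~ e) = 1.
Proof.
by case: e; rewrite /bmw_letter /= ?mulrV ?mulVr ?bmw_gen_unit.
Qed.

Lemma bmw_letter_braid k l e :
  bmw [:: (k, e); (l, e); (k, e)] = bmw [:: (l, e); (k, e); (l, e)].
Proof.
rewrite !bmw_cons bmw_nil !mulr1; case: e; rewrite /bmw_letter /= !mulrA.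
  exact: bmw_gen_braid.
by rewrite -!invrM ?unitrMl ?bmw_gen_unit // !mulrA bmw_gen_braid.
Qed.

Definition bmw_trace (x : braid3) : F := \tr (bmw x).

Lemma bmw_trace_cat x y : bmw_trace (x ++ y) = bmw_trace (y ++ x).
Proof. by rewrite /bmw_trace !bmw_cat; apply: mxtrace_mulrC. Qed.

(** The skein relation g + g^-1 = z (1 + e) solved for e. *)
Definition bmw_e (k : 'I_2) : 'M[F]_3 :=
  z^-1 *: (bmw_gen k + (bmw_gen k)^-1) - 1.

(** The factor d of a disjoint circle: closing the skein relation at a single crossing gives a +
    a^-1 = z (1 + d). *)
Definition loop_value : F := (a + a^-1) / z - 1.

Hypothesis z_neq0 : z != 0.

Lemma bmw_e0 : bmw_e 0 =
  mx3 [:: [:: loop_value; a; 1]; [:: 0; 0; 0]; [:: 0; 0; 0]].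
Proof.
rewrite /bmw_e /loop_value bmw_genV /bmw_gen /bmw_gen_inv /=.
mx3_eq; by field; rewrite ?a_neq0 ?z_neq0.
Qed.

(** [bmw_e 0] has a single nonzero row, which the trace pairs with the first column of [M]. In
    [L_hook0] this row reappears as the values of L on the ideal basis. *)
Lemma mxtrace_bmw_e0 (M : 'M[F]_3) :
  \tr (M * bmw_e 0) = \sum_(j < 3) nth 0 [:: loop_value; a; 1] j * M j 0.
Proof.
rewrite /mxtrace bmw_e0; apply: eq_bigr => j _.
rewrite mxE big_ord_recl big1 => [|i _].
  by rewrite addr0 mxE /= mulrC.
by rewrite mxE /=; case: i => [[|[|?]] ?] //=; case: j => [[|[|[|?]]] ?]; rewrite ?mulr0.
Qed.

(** By the braid relation g_1 g_2 conjugates g_1 into g_2, hence also their inverses, and e is a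
    combination of g, g^-1 and 1. *)
Lemma bmw_e_conj :
  bmw_gen 0 * bmw_gen 1 * bmw_e 0 = bmw_e 1 * (bmw_gen 0 * bmw_gen 1).
Proof.
have h := bmw_gen_braid 0 1; have u0 := bmw_gen_unit 0; have u1 := bmw_gen_unit 1.
rewrite /bmw_e mulrBr mulrBl mulr1 mul1r -scalerAr -scalerAl mulrDr mulrDl.
congr (_ *: (_ + _) - _); first by rewrite h !mulrA.
apply: (mulrI u1); apply: (mulIr u0).
by rewrite !mulrA divrr // mul1r mulrVK // h.
Qed.

Lemma bmw_trace_skein k x y :
  bmw_trace (x ++ (k, true) :: y) + bmw_trace (x ++ (k, false) :: y)
    = z * (bmw_trace (x ++ y) + \tr (bmw x * bmw_e k * bmw y)).
Proof.
rewrite /bmw_trace !bmw_cat !bmw_cons /bmw_letter -!mxtraceD -mxtraceZ.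
congr mxtrace; rewrite /= /bmw_e mulrBr mulrBl mulr1 [X in z *: X]addrC subrK.
by rewrite -scalerAr -scalerAl scalerA divff // scale1r !mulrA mulrDr mulrDl.
Qed.

Lemma bmw_trace_nil : bmw_trace [::] = 3%:R.
Proof. by rewrite /bmw_trace bmw_nil mxtrace1. Qed.

Lemma bmw_trace_gen1 : bmw_trace [:: (1, true)] = z + a^-1.
Proof.
rewrite /bmw_trace bmw_cons bmw_nil mulr1 /bmw_letter /bmw_gen /=.
by rewrite /mxtrace !big_ord_recl big_ord0 !mxE /=; ring.
Qed.

Lemma bmw_trace_gen01 : bmw_trace [:: (0, true); (1, true)] = 0.
Proof.
rewrite /bmw_trace !bmw_cons bmw_nil mulr1 /bmw_letter /bmw_gen /=.
by rewrite /mxtrace !(big_ord_recl, big_ord0, mxE) /=; ring.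
Qed.

End BMWRepresentation.

Lemma rmorph_bmw_trace (F G : fieldType) (phi : {rmorphism F -> G}) a z x :
  a != 0 -> phi (bmw_trace a z x) = bmw_trace (phi a) (phi z) x.
Proof.
move=> a0; have pa0 : phi a != 0 by rewrite fmorph_eq0.
rewrite /bmw_trace -trace_map_mx; congr mxtrace.
rewrite /bmw rmorph_prod; apply: eq_bigr => -[k e] _.
have mx3_map rows : map_mx phi (mx3 rows) = mx3 (map (map phi) rows).
  apply/matrixP => i j; rewrite !mxE.
  have [hi|hi] := ltnP i (size rows); last first.
    rewrite (nth_default _ hi) (@nth_default _ [::] (map _ rows)) ?size_map //.
    by rewrite !nth_nil rmorph0.
  rewrite (nth_map [::]) //; have [hj|hj] := ltnP j (size (nth [::] rows i)).
    by rewrite (nth_map 0).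
  by rewrite (nth_default _ hj) rmorph0 nth_default ?size_map.
by rewrite /bmw_letter /= !bmw_genV // /bmw_gen /bmw_gen_inv;
  case: e; case: ifP => _;
  rewrite mx3_map /= ?(rmorphM, fmorphV, rmorphN, rmorph0, rmorph1).
Qed.

(** * The Kauffman polynomial of 3-braids *)

Section Kauffman.
Variables (K : fieldType) (a z : K) (L : udiagram -> K).
Hypotheses (a_neq0 : a != 0) (z_neq0 : z != 0).
Hypothesis hL : regular_invariant (@id unit) a L.
Hypothesis L_unknot : L [:: (Cup tt, 0%N); (Cap, 0%N)] = 1.

Hypothesis L_skein : forall u v i, ulink (u ++ (Cross true, i) :: v) ->
  L (u ++ (Cross true, i) :: v) + L (u ++ (Cross false, i) :: v)
    = z * (L (u ++ v) + L (u ++ hook i ++ v)).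

Local Notation C3 := (closure3 tt).
Local Notation B := (braid_slices unit).
Local Notation w6 := [:: tt; tt; tt; tt; tt; tt].

Lemma L_skein_at u v w w' i D : in_context id u v w w' ->
    run id w ((Cross true, i) :: D) = Some w' ->
  L (u ++ ((Cross true, i) :: D) ++ v) + L (u ++ ((Cross false, i) :: D) ++ v)
    = z * (L (u ++ D ++ v) + L (u ++ (hook i ++ D) ++ v)).
Proof. by move=> h /(in_context_link h) hD; rewrite L_skein -?catA. Qed.

Let h0 : in_context (@id unit) [::] [::] [::] [::]. Proof. by []. Qed.
Let opK : involutive (@id unit). Proof. by []. Qed.

(** Both crossings in the skein relation become curls of one circle and the hook closes up to one
    circle, so the relation determines the two-circle diagram. *)
Lemma L_closure2_nil : L (closure2 tt [::]) = loop_value a z.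
Proof.
have hook0 : L (closure2 tt (hook 0)) = 1.
  rewrite -[closure2 _ _]cats0 -[_ ++ [::]]cat0s.
  iso h0 1%N (Move_zigzag_r id tt 0).
  by iso h0 1%N (Move_zigzag_l id tt 0).
have := @L_skein [:: (Cup tt, 0%N); (Cup tt, 1%N)] [:: (Cap, 1%N); (Cap, 0%N)] 0%N erefl.
have /= -> := markov_closure2 opK hL tt true.
have /= -> := markov_closure2 opK hL tt false.
rewrite L_unknot !mulr1 [X in z * (_ + X)]hook0 /loop_value => ->.
by rewrite mulrC mulKf // addrK.
Qed.

Lemma L_closure3_nil : L (C3 [::]) = loop_value a z ^+ 2.
Proof.
have hook1 : L (C3 (hook 1)) = loop_value a z.
  rewrite -[C3 _]cats0 -[_ ++ [::]]cat0s.
  iso h0 2%N (Move_zigzag_r id tt 1).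
  iso h0 2%N (Move_zigzag_l id tt 1).
  by rewrite cats0 L_closure2_nil.
have := @L_skein [:: (Cup tt, 0%N); (Cup tt, 1%N); (Cup tt, 2%N)]
  [:: (Cap, 2%N); (Cap, 1%N); (Cap, 0%N)] 1%N erefl.
have /= -> := markov_closure3 opK hL tt true.
have /= -> := markov_closure3 opK hL tt false.
rewrite L_closure2_nil -mulrDl [X in z * (_ + X)]hook1.
set d := loop_value a z => E.
apply: (mulfI z_neq0); apply: (addIr (z * d)); rewrite -mulrDr -E.
by rewrite /d /loop_value; field; rewrite a_neq0 z_neq0.
Qed.

Lemma L_closure3_gen1 : L (C3 [:: (Cross true, 1%N)]) = a * loop_value a z.
Proof. by rewrite (markov_closure3 opK hL) L_closure2_nil. Qed.

Lemma L_closure3_gen01 :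
  L (C3 [:: (Cross true, 0%N); (Cross true, 1%N)]) = a ^+ 2.
Proof.
by rewrite (markov_closure3_mul opK hL) (markov_closure2 opK hL) L_unknot mulr1.
Qed.

(* e_1, g_2 e_1 and e_2 e_1, a basis of the left ideal generated by e_1. *)
Definition ideal_basis (j : nat) : udiagram :=
  nth [::] [:: hook 0;
               (Cross true, 1%N) :: hook 0;
               [:: (Cap, 1%N); (Cup tt, 0%N)]] j.

(** The functional sending y to L of the closure of x y, restricted to the left ideal and written as
    a row. A letter appended to x acts on the basis, hence multiplies the row on the right by a
    matrix. *)
Definition ideal_values (x : braid3) : 'rV[K]_3 :=
  \row_j L (C3 (B x ++ ideal_basis j)).

(** The circles lie side by side here, whereas those of [closure2] are nested; the skein relation is
    applied to a crossing between their neighbouring strands. *)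
Lemma L_two_circles :
  L [:: (Cup tt, 0%N); (Cup tt, 2%N); (Cap, 2%N); (Cap, 0%N)] = loop_value a z.
Proof.
have hook1 : L [:: (Cup tt, 0%N); (Cup tt, 2%N); (Cap, 1%N); (Cup tt, 1%N);
    (Cap, 2%N); (Cap, 0%N)] = 1.
  rewrite -[X in L X]cats0 -[_ ++ [::]]cat0s.
  iso h0 1%N (Move_zigzag_r id tt 1).
  by iso h0 1%N (Move_zigzag_l id tt 1).
have curled e : L [:: (Cup tt, 0%N); (Cup tt, 2%N); (Cross e, 1%N); (Cap, 2%N);
    (Cap, 0%N)] = if e then a else a^-1.
  rewrite -[X in L X]cats0 -[_ ++ [::]]cat0s; case: e.
    iso_back h0 1%N (Move_slide_cup id tt false 1).
    uncurl h0 2%N (Curl_cap id false 2).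
    by iso h0 1%N (Move_zigzag_l id tt 1); rewrite L_unknot mulr1.
  iso_back h0 1%N (Move_slide_cup id tt true 1).
  uncurl h0 2%N (Curl_cap id true 2).
  by iso h0 1%N (Move_zigzag_l id tt 1); rewrite L_unknot mulr1.
have := @L_skein [:: (Cup tt, 0%N); (Cup tt, 2%N)] [:: (Cap, 2%N); (Cap, 0%N)] 1%N erefl.
rewrite /= hook1 !curled /loop_value => ->.
by rewrite mulrC mulKf // addrK.
Qed.

(** This list is the nonzero row of [bmw_e 0], which is why L and chi_0 agree on the ideal. *)
Lemma ideal_values_nil j : ideal_values [::] 0 j = nth 0 [:: loop_value a z; a; 1] j.
Proof.
rewrite mxE; case: j => [[|[|[|?]]] ?] //=; rewrite -[C3 _]cats0 -[_ ++ [::]]cat0s.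
all: rewrite /ideal_basis [nth _ _ _]/=.
- iso h0 4%N (Move_far id (Cup tt) Cap (leqnn 0)).
  iso h0 5%N (Move_zigzag_l id tt 0).
  iso_back h0 2%N (Move_far id Cap (Cup tt) (leqnn 0)).
  iso h0 1%N (Move_zigzag_r id tt 0).
  iso_back h0 0%N (Move_far id (Cup tt) (Cup tt) (leqnn 0)).
  iso h0 2%N (Move_far id Cap Cap (leqnn 0)).
  exact: L_two_circles.
- iso h0 5%N (Move_far id (Cup tt) Cap (leqnn 0)).
  iso h0 6%N (Move_zigzag_l id tt 0).
  iso h0 4%N (Move_far id Cap Cap (leqnn 0)).
  iso_back h0 2%N (Move_slide_cup id tt false 1).
  uncurl h0 3%N (Curl_cap id false 2).
  iso h0 2%N (Move_zigzag_l id tt 1).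
  iso h0 1%N (Move_zigzag_r id tt 0).
  by rewrite L_unknot mulr1.
iso h0 2%N (Move_zigzag_r id tt 1).
iso h0 2%N (Move_far id (Cup tt) Cap (leqnn 0)).
iso h0 1%N (Move_zigzag_r id tt 0).
by iso h0 1%N (Move_zigzag_l id tt 0).
Qed.

Section IdealAction.
Variables (u v : udiagram).
Hypothesis h : in_context (@id unit) u v w6 w6.
Local Notation "<< D >>" := (L (u ++ D ++ v)).

Lemma gen0_ideal_basis0 : << (Cross true, 0%N) :: hook 0 >> = a^-1 * << hook 0 >>.
Proof. by uncurl h 0%N (Curl_cap id true 0). Qed.

(** g_2 below the cap of e_1 slides to g_1^-1 below the cap of e_2, and g_1^-1 cancels g_1. *)
Lemma gen0_ideal_basis1 : << [:: (Cross true, 0%N), (Cross true, 1%N) & hook 0] >>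
  = << ideal_basis 2 >>.
Proof.
iso_back h 1%N (Move_slide_cap id false 0).
by iso h 0%N (Move_R2 id true 0).
Qed.

(** A slide gives g_1 e_2 e_1 = g_2^-1 e_1, and the skein relation expands g_2^-1. *)
Lemma gen0_ideal_basis2 : << (Cross true, 0%N) :: ideal_basis 2 >>
  = z * << hook 0 >> - << (Cross true, 1%N) :: hook 0 >> + z * << ideal_basis 2 >>.
Proof.
have e21 : << hook 1 ++ hook 0 >> = << ideal_basis 2 >>.
  by iso h 1%N (Move_zigzag_r id tt 0).
rewrite /ideal_basis [nth _ _ _]/=; iso h 0%N (Move_slide_cap id true 0).
have /(canRL (addKr _)) -> := L_skein_at h (i := 1) (D := hook 0) erefl.
by rewrite e21 mulrDr addrA [- _ + _]addrC.
Qed.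

(** In the skein relation at the first g_2, the inverse crossing cancels the second g_2, and the
    hook forms a curl with it: e_2 g_2 = a^-1 e_2. *)
Lemma gen1_ideal_basis1 : << [:: (Cross true, 1%N), (Cross true, 1%N) & hook 0] >>
  = - << hook 0 >> + z * << (Cross true, 1%N) :: hook 0 >>
    + a^-1 * z * << ideal_basis 2 >>.
Proof.
have r2 : << [:: (Cross false, 1%N), (Cross true, 1%N) & hook 0] >> = << hook 0 >>.
  by iso h 0%N (Move_R2 id false 1).
have e21 : << hook 1 ++ (Cross true, 1%N) :: hook 0 >> = a^-1 * << ideal_basis 2 >>.
  uncurl h 1%N (Curl_cup id tt true 1).
  by iso h 1%N (Move_zigzag_r id tt 0).
have /(canRL (addrK _)) -> :=
  L_skein_at h (i := 1) (D := (Cross true, 1%N) :: hook 0) erefl.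
by rewrite e21 r2 mulrDr addrC addrA mulrA [z * a^-1]mulrC.
Qed.

Lemma gen1_ideal_basis2 : << (Cross true, 1%N) :: ideal_basis 2 >>
  = a^-1 * << ideal_basis 2 >>.
Proof. by rewrite /ideal_basis [nth _ _ _]/=; uncurl h 0%N (Curl_cap id true 1). Qed.

End IdealAction.

(** The expansions of g_k times the basis elements are the columns of [bmw_gen]; g_2 e_1 is itself a
    basis element. *)
Lemma ideal_values_gen x (k : 'I_2) :
  ideal_values (x ++ [:: (k, true)]) = ideal_values x *m bmw_gen a z k.
Proof.
set cups := [:: (Cup tt, 0%N); (Cup tt, 1%N); (Cup tt, 2%N)].
set caps := [:: (@Cap unit, 2%N); (Cap, 1%N); (Cap, 0%N)].
have h : in_context (@id unit) (cups ++ B x) caps w6 w6.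
  by split=> //; apply: labels_cups_braid.
have C3E D : L (C3 (B x ++ D)) = L ((cups ++ B x) ++ D ++ caps).
  by rewrite /closure3 -!catA.
apply/rowP => j; rewrite !mxE braid_slices_cat -catA C3E.
rewrite !big_ord_recl big_ord0 !mxE !C3E /ideal_basis /bmw_gen.
case: k => [[|[|?]] //= hk]; case: j => [[|[|[|?]]] ?] //=; rewrite !mxE /=.
- by move: (gen0_ideal_basis0 h); rewrite /ideal_basis /= => ->; ring.
- by move: (gen0_ideal_basis1 h); rewrite /ideal_basis /= => ->; ring.
- by move: (gen0_ideal_basis2 h); rewrite /ideal_basis /= => ->; ring.
- by ring.
- by move: (gen1_ideal_basis1 h); rewrite /ideal_basis /= => ->; ring.
by move: (gen1_ideal_basis2 h); rewrite /ideal_basis /= => ->; ring.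
Qed.


Lemma ideal_link x j : (j < 3)%N ->
  is_link (@id unit) (C3 (B x ++ ideal_basis j)).
Proof. by rewrite /is_link labels_closure3; case: j => [|[|[|]]]. Qed.

Lemma ideal_values_letter x s :
  ideal_values (x ++ [:: s]) = ideal_values x *m bmw_letter a z s.
Proof.
case: s => k []; first exact: ideal_values_gen.
(* An inverse letter followed by its generator cancels by R2, so it acts by the inverse matrix. *)
suff E : ideal_values x = ideal_values (x ++ [:: (k, false)]) *m bmw_gen a z k.
  rewrite E /bmw_letter /= -mulmxA -[X in _ *m X]/(_ * _)%R divrr ?mulmx1 //.
  exact: bmw_gen_unit.
rewrite -ideal_values_gen -catA; apply/rowP => j; rewrite !mxE.
by rewrite (closure3_R2 hL _ false) //; apply: ideal_link.
Qed.

Lemma ideal_values_bmw x : ideal_values x = ideal_values [::] *m bmw a z x.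
Proof.
elim/last_ind: x => [|x s IH]; first by rewrite bmw_nil mulmx1.
by rewrite -cats1 ideal_values_letter IH bmw_cat bmw_cons bmw_nil mulr1 mulmxA.
Qed.

Lemma L_hook0 x : L (C3 (B x ++ hook 0)) = \tr (bmw a z x * bmw_e a z 0).
Proof.
transitivity (ideal_values x 0 0); first by rewrite mxE.
rewrite mxtrace_bmw_e0 // ideal_values_bmw mxE; apply: eq_bigr => j _.
by rewrite ideal_values_nil.
Qed.

Lemma run_braid_hook x y k :
  run (@id unit) [:: tt; tt; tt] (B x ++ hook (k : 'I_2) ++ B y) = Some [:: tt; tt; tt].
Proof.
apply: run_cat_some (run_braid_slices _ _ _) _.
apply: run_cat_some (run_braid_slices _ _ _).
by case: k => [[|[|?]] ?].
Qed.

(** The letters of y go round the closure one at a time, the last one first. *)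
Lemma L_hook_cyclic x y (k : 'I_2) :
  L (C3 (B x ++ hook k ++ B y)) = L (C3 (B (y ++ x) ++ hook k)).
Proof.
elim/last_ind: y x => [|y [l e] IH] x; first by rewrite cats0.
rewrite cat_rcons -IH.
have -> : B x ++ hook k ++ B (rcons y (l, e))
    = (B x ++ hook k ++ B y) ++ [:: (Cross e, nat_of_ord l)].
  by rewrite -cats1 braid_slices_cat -!catA.
by rewrite (closure3_cyclic hL) //; apply: run_braid_hook.
Qed.

(* e_2 (g_1 g_2) = (g_1 g_2) e_1. *)
Lemma L_hook_conj x :
  L (C3 (B x ++ hook 1 ++ B [:: (0, true); (1, true)]))
    = L (C3 (B (x ++ [:: (0, true); (1, true)]) ++ hook 0)).
Proof.
have h : in_context (@id unit)
    ([:: (Cup tt, 0%N); (Cup tt, 1%N); (Cup tt, 2%N)] ++ B x)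
    [:: (Cap, 2%N); (Cap, 1%N); (Cap, 0%N)] w6 w6.
  by split=> //; apply: labels_cups_braid.
rewrite /closure3 braid_slices_cat -[(B x ++ _) ++ hook 0]catA.
rewrite -![(B x ++ _) ++ _]catA ![_ ++ B x ++ _]catA.
rewrite -[hook 1 ++ _]/[:: (Cap, 1%N); (Cup tt, 1%N);
  (Cross true, 0%N); (Cross true, 1%N)].
rewrite -[B _ ++ hook 0]/[:: (Cross true, 0%N); (Cross true, 1%N);
  (Cap, 0%N); (Cup tt, 0%N)].
rewrite [RHS](gen0_ideal_basis1 h) /ideal_basis [nth _ _ _]/=.
iso_back h 1%N (Move_slide_cup id tt false 0).
by iso h 2%N (Move_R2 id false 1).
Qed.

Lemma L_hook1 x : L (C3 (B x ++ hook 1)) = \tr (bmw a z x * bmw_e a z 1).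
Proof.
pose g01 : braid3 := [:: (0, true); (1, true)].
(* y = (g_1 g_2)^-1 x: cycling g_1 g_2 to the front of y recovers x, while moving it through e_2
   turns e_2 into e_1, where [L_hook0] applies. *)
pose y : braid3 := [:: (1, false); (0, false)] ++ x.
have link w : is_link (@id unit) (C3 (B w ++ hook 1)).
  apply: link_closure3; have := run_braid_hook w [::] 1%R; by rewrite cats0.
transitivity (L (C3 (B y ++ hook 1 ++ B g01))).
  rewrite (L_hook_cyclic y g01 1%R).
  rewrite -[g01 ++ y]/([:: (0, true)] ++ [:: (1, true); (1, false)]
    ++ [:: (0, false)] ++ x).
  rewrite catA braid_slices_cat -[(B _ ++ _) ++ _]catA (closure3_R2 hL _ true).
    rewrite catA -braid_slices_cat.
    rewrite -[_ ++ _ ++ x]/([::] ++ [:: (0, true); (0, false)] ++ x).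
    rewrite catA braid_slices_cat -catA (closure3_R2 hL _ true) //.
    exact: link.
  by rewrite catA -braid_slices_cat; apply: link.
have u0 := bmw_gen_unit z a_neq0 0; have u1 := bmw_gen_unit z a_neq0 1.
rewrite L_hook_conj L_hook0 bmw_cat /y bmw_cat !bmw_cons bmw_nil /bmw_letter /= !mulr1.
rewrite -!mulrA [bmw_gen a z 0 * (bmw_gen a z 1 * _)]mulrA bmw_e_conj //.
rewrite mulrA [LHS]mxtrace_mulrC.
by congr mxtrace; rewrite !mulrA !mulrK.
Qed.

Lemma L_hook_trace x y (k : 'I_2) :
  L (C3 (B x ++ hook k ++ B y)) = \tr (bmw a z x * bmw_e a z k * bmw a z y).
Proof.
rewrite L_hook_cyclic [RHS]mxtrace_mulrC mulrA -bmw_cat.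
by case: (ord2P k) => ->; rewrite ?L_hook0 ?L_hook1.
Qed.

(* The part of L coming from the summands of the BMW algebra that factor
   through the Hecke algebra. *)
Definition hecke_part (x : braid3) : K := L (C3 (B x)) - bmw_trace a z x.

(** The hook terms of L and of the trace agree by [L_hook_trace] and cancel. *)
Lemma hecke_part_skein x y k :
  hecke_part (x ++ (k, true) :: y) + hecke_part (x ++ (k, false) :: y)
    = z * hecke_part (x ++ y).
Proof.
rewrite /hecke_part addrACA -opprD bmw_trace_skein //.
suff -> : L (C3 (B (x ++ (k, true) :: y))) + L (C3 (B (x ++ (k, false) :: y)))
    = z * (L (C3 (B (x ++ y))) + L (C3 (B x ++ hook k ++ B y))).
  by rewrite L_hook_trace -mulrBr opprD addrACA subrr addr0.
have link : is_link (@id unit) (C3 (B (x ++ (k, true) :: y))).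
  by apply: link_closure3; apply: run_braid_slices.
have := @L_skein ([:: (Cup tt, 0%N); (Cup tt, 1%N); (Cup tt, 2%N)] ++ B x)
  (B y ++ [:: (Cap, 2%N); (Cap, 1%N); (Cap, 0%N)]) k.
by move: link; rewrite /closure3 !braid_slices_cat -!catA /= => h; apply.
Qed.

Lemma hecke_part_function : braid_function hecke_part.
Proof.
have [R2 R3] := braid_function_closure3 hL tt.
split=> x y k => [e|l e]; rewrite /hecke_part (R2, R3) /bmw_trace !bmw_cat.
  by rewrite !bmw_cons bmw_nil mulr1 bmw_letterK // mul1r.
by rewrite bmw_letter_braid.
Qed.

Lemma hecke_part_conj x s : hecke_part (x ++ [:: s]) = hecke_part (s :: x).
Proof. by rewrite /hecke_part (closure3_conj hL) bmw_trace_cat. Qed.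

Lemma hecke_part_nil : hecke_part [::] = loop_value a z ^+ 2 - 3%:R.
Proof. by rewrite /hecke_part L_closure3_nil bmw_trace_nil. Qed.

Lemma hecke_part_gen1 : hecke_part [:: (1, true)] = a * loop_value a z - (z + a^-1).
Proof. by rewrite /hecke_part L_closure3_gen1 bmw_trace_gen1. Qed.

Lemma hecke_part_gen01 : hecke_part [:: (0, true); (1, true)] = a ^+ 2.
Proof. by rewrite /hecke_part L_closure3_gen01 bmw_trace_gen01 subr0. Qed.

End Kauffman.

(** * Functions on braids with a Hecke skein relation *)

Section HeckeFunctional.
Variables (K : comRingType) (z : K).

Definition hecke_skein (F : braid3 -> K) : Prop := forall x y k,
  F (x ++ (k, true) :: y) - F (x ++ (k, false) :: y) = z * F (x ++ y).

Local Notation g0 := ((0, true) : 'I_2 * bool).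
Local Notation g1 := ((1, true) : 'I_2 * bool).

(** The relation g - g^-1 = z multiplied by g is the quadratic relation of the Hecke algebra. *)
Lemma hecke_square F x y k : braid_function F -> hecke_skein F ->
  F (x ++ [:: (k, true), (k, true) & y]) = F (x ++ y) + z * F (x ++ (k, true) :: y).
Proof.
move=> hF hs; rewrite -(hs _ _ k).
by rewrite -(braid_R2 hF x y k false) /= addrC subrK.
Qed.

(** One reduced word for each permutation in S_3: the standard basis of the Hecke algebra. *)
Definition hecke_basis : seq braid3 :=
  [:: [::]; [:: g0]; [:: g1]; [:: g0; g1]; [:: g1; g0]; [:: g0; g1; g0]].

Lemma hecke_basis_gen F k : braid_function F -> hecke_skein F ->
  all (fun b => F b == 0) hecke_basis ->
  all (fun b => F ((k, true) :: b) == 0) hecke_basis.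
Proof.
move=> hF hs /= /and5P[/eqP n /eqP n0 /eqP n1 /eqP n01 /and3P[/eqP n10 /eqP n010 _]].
have sq := hecke_square _ _ _ hF hs.
have R3 y : F [:: g1, g0, g1 & y] = F [:: g0, g1, g0 & y].
  exact: (braid_R3 hF [::] y 1 0 true).
have sq2 u u' v l : F [:: u, u', (l, true), (l, true) & v]
    = F [:: u, u' & v] + z * F [:: u, u', (l, true) & v].
  exact: (sq [:: u; u']).
have {}sq v l : F [:: (l, true), (l, true) & v] = F v + z * F ((l, true) :: v).
  exact: (sq [::]).
have [->|->] := ord2P k.
all: rewrite !(sq, R3, sq2).
all: by rewrite !(n, n0, n1, n01, n10, n010, mulr0, addr0) eqxx.
Qed.

(* Left translates of F satisfy the same hypotheses, so F can be fed one letter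
   at a time. *)
Lemma hecke_functional_eq0 F x : braid_function F -> hecke_skein F ->
  all (fun b => F b == 0) hecke_basis -> F x = 0.
Proof.
elim: x F => [|[k e] x IH] F hF hs hb; first by case/and5P: hb => /eqP.
apply: (IH (fun y => F ((k, e) :: y))).
- by split=> u v ? => [?|? ?];
    [exact: (braid_R2 hF (_ :: u))|exact: (braid_R3 hF (_ :: u))].
- by move=> u v l; apply: (hs (_ :: u)).
have {}pos := hecke_basis_gen k hF hs hb; case: e => //.
(* The skein relation expresses g^-1 b through g b and b. *)
have neg b : F b == 0 -> F ((k, true) :: b) == 0 -> F ((k, false) :: b) == 0.
  move=> /eqP b0 /eqP kb0; have /eqP := hs [::] b k.
  by rewrite /= b0 kb0 sub0r mulr0 oppr_eq0.
elim: hecke_basis hb pos => //= b s IHs /andP[hb hs'] /andP[pb ps].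
by rewrite neg //= IHs.
Qed.

(** Conjugation reduces the six basis values to three: g_1 is conjugate to g_2, g_2 g_1 to g_1 g_2,
    and g_1 g_2 g_1 to g_1^2 g_2, which the quadratic relation expands. *)
Lemma hecke_functional_unique F G x : braid_function F -> braid_function G ->
  hecke_skein F -> hecke_skein G ->
  (forall y s, F (y ++ [:: s]) = F (s :: y)) ->
  (forall y s, G (y ++ [:: s]) = G (s :: y)) ->
  F [::] = G [::] -> F [:: g1] = G [:: g1] -> F [:: g0; g1] = G [:: g0; g1] ->
  F x = G x.
Proof.
move=> hF hG sF sG cF cG e e1 e01; apply/eqP; rewrite -subr_eq0; apply/eqP.
have conj H : braid_function H -> hecke_skein H ->
    (forall y s, H (y ++ [:: s]) = H (s :: y)) ->
  [/\ H [:: g0] = H [:: g1], H [:: g1; g0] = H [:: g0; g1]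
    & H [:: g0; g1; g0] = H [:: g1] + z * H [:: g0; g1]].
  move=> hH sH cH; split.
  (* The word g_1 g_2 g_1 g_2^-1 g_1^-1 reduces to g_2 by the braid relation, and to g_1 once its
     last two letters are moved to the front. *)
  - have := braid_R3 hH [::] [:: (1, false); (0, false)] 0 1 true.
    have := braid_R2 hH [:: g1; g0] [:: (0, false)] 1 true.
    have /= -> := braid_R2 hH [:: g1] [::] 0 true.
    move=> /= -> E.
    have /= := cH [:: g0; g1; g0; (1, false)] (0, false); rewrite E => ->.
    have /= := cH [:: (0, false); g0; g1; g0] (1, false).
    move=> /= ->; have /= -> := braid_R2 hH [:: (1, false)] [:: g1; g0] 0 false.
    by have /= -> := braid_R2 hH [::] [:: g0] 1 false.
  - by have /= -> := cH [:: g0] g1.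
  have /= -> := cH [:: g0; g1] g0.
  exact: (hecke_square [::] [:: g1] 0 hH sH).
have [F0 F10 F010] := conj F hF sF cF; have [G0 G10 G010] := conj G hG sG cG.
apply: (@hecke_functional_eq0 (fun y => F y - G y)).
- split=> u v k => [s|l s]; first by rewrite (braid_R2 hF) (braid_R2 hG).
  by rewrite (braid_R3 hF) (braid_R3 hG).
- by move=> u v k; rewrite opprD addrACA -opprD sF sG -mulrBr.
by rewrite /= F010 G010 F10 G10 F0 G0 e e1 e01 !subrr eqxx.
Qed.

End HeckeFunctional.

(** * Parity of the writhe of a knot *)

Definition exponent_sum (x : braid3) : int := \sum_(s <- x) (if s.2 then 1 else -1).

Lemma exponent_sum_cat x y : exponent_sum (x ++ y) = exponent_sum x + exponent_sum y.
Proof. exact: big_cat. Qed.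

Lemma exponent_sum_cons s x :
  exponent_sum (s :: x) = (if s.2 then 1 else -1) + exponent_sum x.
Proof. exact: big_cons. Qed.

Lemma writhe_braid_closure x : writhe (braid_closure x) = exponent_sum x.
Proof.
rewrite /writhe /=; rewrite !add0r.
elim: x => [|[[k hk] e] x IH]; first by rewrite /exponent_sum big_nil.
rewrite exponent_sum_cons -IH.
by case: k hk => [|[]] // hk; case: e.
Qed.

Lemma signr_exponent_sum (R : fieldType) x :
  (-1) ^ exponent_sum x = (-1) ^+ size x :> R.
Proof.
elim: x => [|s x IH]; first by rewrite /exponent_sum big_nil.
rewrite exponent_sum_cons expfzDr ?oppr_eq0 ?oner_eq0 // IH exprS.
by case: s => k [] /=; rewrite ?expr1z ?exprN1 ?invrN1.
Qed.

(** * Two-colourings of a diagram *)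

Section Coloring.

Lemma step_through (w w' : seq bool) s p p' :
  step id w s = Some w' -> through s p = Some p' -> nth true w p = nth true w' p'.
Proof.
case: s => g i; have [hi|hi] := leqP i (size w); last first.
  by rewrite /= drop_oversize ?(ltnW hi) // leqNgt hi; case: g.
rewrite -{2}(cat_take_drop i w) /=.
have : size (take i w) = i by rewrite size_takel.
move: (take i w) (drop i w) => l r hl.
case: g => [o||e] /=.
- rewrite hi addn0 subn0 => -[<-] {w'}; rewrite !nth_cat hl.
  case: (ltnP p i) => /= hp [<-]; first by rewrite hp.
  have -> : (p + 2 < i)%N = false by lia.
  by have -> : (p + 2 - i = (p - i).+2)%N by lia.
- case: r => [|a [|b r]] //; case: ifP => // _ [<-] {w'}; rewrite !nth_cat hl.
  case: (ltnP p i) => /= hp; first by case=> <-; rewrite hp.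
  case: (leqP (i + 2) p) => //= hp2 [<-]; have -> : (p - 2 + 0 < i)%N = false by lia.
  by have -> : (p - i = (p - 2 + 0 - i).+2)%N by lia.
case: r => [|a [|b r]] // [<-] {w'}; rewrite !nth_cat hl.
case: (ltnP p i) => /= hp; first by case=> <-; rewrite hp.
case: (leqP (i + 2) p) => /= hp2 [<-].
  have -> : (p - 2 + 2 < i)%N = false by lia.
  have -> : (p - i = (p - 2 - i).+2)%N by lia.
  by have -> : (p - 2 + 2 - i = (p - 2 - i).+2)%N by lia.
have [->|hne] := eqVneq p i.
  by rewrite ltnNge leqnSn /= subnn subSnn.
have -> : p = i.+1 by lia.
by rewrite ltnn subSnn subnn.
Qed.

Lemma through_forget s s' p :
  forget [:: s'] = forget [:: s] -> through s' p = through s p.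
Proof.
by case: s => [[?||?] ?]; case: s' => [[?||?] ?] //= [];
  [move=> ->|move=> ->|move=> _ ->].
Qed.

Lemma step_cup (w w' : seq bool) o i :
  step id w (Cup o, i) = Some w' -> nth true w' i = nth true w' i.+1.
Proof.
rewrite /=; case: leqP => // hi [<-].
by rewrite !nth_cat size_takel // ltnn subnn ltnNge leqnSn subSnn.
Qed.

Lemma step_cap (w w' : seq bool) i :
  step id w (Cap, i) = Some w' -> nth true w i = nth true w i.+1.
Proof.
rewrite /=; case E: (drop i w) => [|a [|b t]] //; case: ifP => // /eqP hab _.
have := nth_drop i true w 0; have := nth_drop i true w 1.
by rewrite E /= addn0 addn1 => <- <-.
Qed.

Variables D E : odiagram.
Hypothesis E_link : is_link id E.
Hypothesis E_forget : forget E = forget D.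

(** [E] has the slices of [D] but carries colours instead of directions: with [op = id] a label
    survives turning back, so it is constant along each component. *)
Definition color (P : nat * nat) : bool :=
  nth true (odflt [::] (labels id (take P.1 E))) P.2.

Lemma color_split D1 s D2 : D = D1 ++ s :: D2 ->
  exists2 s', forget [:: s'] = forget [:: s] & exists w w',
    [/\ step id w s' = Some w', forall p, color (size D1, p) = nth true w p
      & forall p, color ((size D1).+1, p) = nth true w' p].
Proof.
move=> hD; have hsz : size E = size D.
  by have := congr1 size E_forget; rewrite !size_map.
have hlt : (size D1 < size E)%N by rewrite hsz hD size_cat /= addnS ltnS leq_addr.
have hE := esym (cat_take_drop (size D1) E).
rewrite (drop_nth s) // in hE; set s' := nth s E (size D1) in hE.
exists s'.
  have := congr1 (fun F => nth (Cap, 0%N) F (size D1)) E_forget.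
  rewrite !(nth_map s) -?hsz // -/s'.
  by rewrite hD nth_cat ltnn subnn /= => ->.
have := E_link; rewrite /is_link hE -[labels _ _]/(run _ _ _) run_cat.
rewrite -[run _ _ _]/(labels _ _); case hw: (labels _ _) => [w|] //=.
rewrite run_cons; case hw': (step id w s') => [w'|] //= _.
exists w, w'; split=> // p; rewrite /color /=; first by rewrite hw.
rewrite (take_nth s) // -/s' -cats1 -[labels _ _]/(run _ _ _) run_cat.
by rewrite -[run _ _ _]/(labels _ _) hw /= run_cons hw'.
Qed.

Lemma color_joined P Q : clos_refl_sym_trans _ (joined D) P Q -> color P = color Q.
Proof.
elim=> {P Q} [P Q|//|P Q _ -> //|P Q R _ -> _ -> //].
case=> [D1 s D2 p p' hD hp|D1 o i D2 hD|D1 i D2 hD].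
- have [s' hs [w [w' [hw -> ->]]]] := color_split hD.
  by apply: step_through hw _; rewrite (through_forget _ hs).
- have [[[o'||e] i'] //= [->] [w [w' [hw _ hw'']]]] := color_split hD.
  by rewrite !hw'' (step_cup hw).
have [[[o'||e] i'] //= [->] [w [w' [hw hw'' _]]]] := color_split hD.
by rewrite !hw'' (step_cap hw).
Qed.

End Coloring.

(** [l] is the permutation of the strands. Each letter is a transposition, so the parity of the
    length decides between the three transpositions and the three even permutations. *)
Lemma run_braid_colors x : exists2 l : seq nat,
    l \in (if odd (size x) then [:: [:: 1; 0; 2]; [:: 2; 1; 0]; [:: 0; 2; 1]]
           else [:: [:: 0; 1; 2]; [:: 1; 2; 0]; [:: 2; 0; 1]])%N &
    forall a b c : bool, run id [:: a; b; c] (braid_slices bool x)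
      = Some [seq nth true [:: a; b; c] i | i <- l].
Proof.
elim: x => [|[[k hk] e] x [l hl IH]]; first by exists [:: 0; 1; 2]%N.
(* The first letter permutes the initial labels, so its transposition acts on the indices listed in
   [l]. *)
exists [seq (if k == 0 then [fun i => i with 0 |-> 1, 1 |-> 0]
             else [fun i => i with 1 |-> 2, 2 |-> 1])%N i | i <- l].
  move: hl; case: k hk => [|[]] //= _; case: (odd _);
    by rewrite !inE => /or3P[]/eqP ->.
move=> a b c; rewrite run_cons.
case: k hk => [|[]] //= _; rewrite IH; move: hl; case: (odd _);
  by rewrite !inE => /or3P[]/eqP ->.
Qed.

(* A transposition of the strands would leave a two-colouring of the closure
   that is not constant. *)
Lemma knot_even_braid x : is_knot (braid_closure x) -> odd (size x) = false.
Proof.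
move=> [_ _ conn]; apply/negbTE/negP => hodd.
(* The strand fixed by the transposition gets one colour, the two exchanged strands the other. *)
have [c [[a b] hc hrun]] : exists c, exists2 ab, (c != ab.1) || (c != ab.2) &
    run id [:: ab.1; ab.2; c] (braid_slices bool x) = Some [:: ab.1; ab.2; c].
  have [l] := run_braid_colors x; rewrite hodd !inE => /or3P[]/eqP -> h.
  - by exists false, (true, true).
  - by exists true, (true, false).
  by exists true, (false, true).
pose E : odiagram := [:: (Cup a, 0%N); (Cup b, 1%N); (Cup c, 2%N)] ++
  braid_slices bool x ++ [:: (Cap, 2%N); (Cap, 1%N); (Cap, 0%N)].
have E_link : is_link id E.
  apply: (@run_cat_some _ _ _ [:: a; b; c; c; b; a]) => //.
  apply: run_cat_some (run_far [:: c; b; a] hrun) _.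
  by rewrite /run /= eqxx /= eqxx /= eqxx.
have E_forget : forget E = forget (braid_closure x) by [].
(* Level 3 is just above the three minima, where the braid starts. *)
have on j : (j < 3)%N -> on_diagram (braid_closure x) (3, j)%N.
  move=> hj; split=> //; exists [:: true; true; true; false; false; false] => //.
    by rewrite /= take0.
  exact: (@leq_trans 3).
have same i j : (i < 3)%N -> (j < 3)%N -> color E (3, i)%N = color E (3, j)%N.
  by move=> hi hj; apply: (color_joined E_link E_forget); apply: conn; apply: on.
move: (same 0 2 isT isT) (same 1 2 isT isT) hc; rewrite /color /= !take0 /= => -> ->.
by rewrite eqxx.
Qed.

Lemma signr_knot (R : fieldType) x : is_knot (braid_closure x) ->
  (-1) ^ exponent_sum x = 1 :> R.
Proof. by move/knot_even_braid => h; rewrite signr_exponent_sum -signr_odd h. Qed.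

(** * Evaluation of rational functions *)

Section Zeros.
Variable C : numClosedFieldType.

Lemma poly_zeros_eq0 (q : {poly C}) : (forall c, q.[c] = 0) -> q = 0.
Proof.
(* In characteristic zero the first [size q] naturals are distinct roots, too many for a nonzero
   q. *)
move=> hq; apply: (@roots_geq_poly_eq0 _ _ [seq (i%:R : C) | i <- iota 0 (size q)]).
- by apply/allP => c _; apply/rootP.
- by rewrite map_inj_uniq ?iota_uniq // => i j /eqP; rewrite eqr_nat => /eqP.
by rewrite size_map size_iota.
Qed.

Lemma big_ord2 (R : Type) (idx : R) (op : Monoid.law idx) (F : 'I_2 -> R) :
  \big[op/idx]_i F i = op (F 0) (F 1).
Proof.
rewrite !big_ord_recl big_ord0 Monoid.mulm1.
by congr (op (F _) (F _)); apply: val_inj.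
Qed.

Lemma mpoly2_zeros_eq0 (p : {mpoly C[2]}) : (forall v, p.@[v] = 0) -> p = 0.
Proof.
move=> hp; apply/mpolyP => m0; rewrite mcoeff0.
(* [q c] is p(c, Y) as a polynomial in Y; [r] below is the coefficient of Y^(m0 1) in p as a
   polynomial in X. *)
pose q c : {poly C} := \sum_(m <- msupp p) (p@_m * c ^+ m 0) *: 'X^(m 1).
have q0 c : q c = 0.
  apply: poly_zeros_eq0 => d; rewrite -[RHS](hp (fun k => if k == 0 then c else d)).
  rewrite mevalE horner_sum; apply: eq_bigr => m _.
  by rewrite hornerZ hornerXn big_ord2 mulrA.
pose r : {poly C} := \sum_(m <- msupp p | m 1 == m0 1) p@_m *: 'X^(m 0).
have r0 : r = 0.
  apply: poly_zeros_eq0 => c; have := congr1 (fun s : {poly C} => s`_(m0 1)) (q0 c).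
  rewrite coef0 coef_sum => E; rewrite -[RHS]E horner_sum big_mkcond.
  apply: eq_bigr => m _; rewrite coefZ coefXn hornerZ hornerXn eq_sym.
  by case: eqP; rewrite ?mulr1 ?mulr0.
have [hm|/memN_msupp_eq0 //] := boolP (m0 \in msupp p).
have := congr1 (fun s : {poly C} => s`_(m0 0)) r0.
rewrite coef0 coef_sum -big_filter.
rewrite (bigD1_seq m0) ?filter_uniq ?msupp_uniq //=; last first.
  by rewrite mem_filter eqxx hm.
rewrite coefZ coefXn eqxx mulr1 big_filter_cond.
rewrite big1 ?addr0 // => m /andP[/eqP h1 hne]; rewrite coefZ coefXn.
case: eqP => h0; rewrite ?mulr0 //; case/eqP: hne; apply/mnmP => i.
by have [->|->] := ord2P i.
Qed.

End Zeros.

Section FractionEvaluation.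
Variable R : idomainType.

Lemma fraction_mul_denom (x : {fraction R}) :
  x * tofrac \d_(repr x) = tofrac \n_(repr x).
Proof.
rewrite -{1}[x]reprK; unlock tofrac; rewrite -[LHS]FracField.pi_mul.
apply/eqmodP; rewrite /= FracField.equivfE /FracField.mulf.
by rewrite !numden_Ratio ?mulf_neq0 ?oner_neq0 ?denom_ratioP //; apply/eqP; ring.
Qed.

End FractionEvaluation.

Section RatEvaluation.
Variable C : numClosedFieldType.
Local Notation K := (ratfun C).
Local Notation X := (ratX C).
Local Notation Y := (ratY C).
Local Notation cst := (@ratC C).

HB.instance Definition _ := GRing.RMorphism.copy cst
  ((@tofrac {mpoly C[2]}) \o (@mpolyC 2 C)).

Definition polyeval (a b : K) : {mpoly C[2]} -> K :=
  mmap cst (fun k : 'I_2 => if k == 0 then a else b).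

HB.instance Definition _ a b := GRing.RMorphism.copy (polyeval a b)
  (mmap cst (fun k : 'I_2 => if k == 0 then a else b)).

Lemma polyevalC a b c : polyeval a b c%:MP = cst c.
Proof. exact: mmapC. Qed.

Lemma polyevalX0 a b : polyeval a b 'X_(0 : 'I_2) = a.
Proof. by rewrite /polyeval mmapX mmap1U. Qed.

Lemma polyevalX1 a b : polyeval a b 'X_(1 : 'I_2) = b.
Proof. by rewrite /polyeval mmapX mmap1U. Qed.

Section Generic.
Variables a b : K.
Hypothesis ev_inj : forall p, polyeval a b p = 0 -> p = 0.

Definition ratmorph (f : K) : K := rateval f a b.

(** [rateval] goes through a chosen representative; by [ev_inj] no nonzero denominator evaluates to
    zero, so every representation of [f] gives the same value. *)
Lemma ratmorphE f n d : d != 0 -> f * tofrac d = tofrac n ->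
  ratmorph f = polyeval a b n / polyeval a b d.
Proof.
move=> d0 fd; rewrite /ratmorph /rateval -!/(polyeval a b _).
have nz p : p != 0 -> polyeval a b p != 0 by apply: contra_neq; apply: ev_inj.
have d'0 := denom_ratioP (repr f); have fd' := fraction_mul_denom f.
apply/eqP; rewrite eqr_div ?nz // -!rmorphM; apply/eqP; congr (polyeval a b _).
apply/eqP; rewrite -tofrac_eq !tofracM -fd -fd'; apply/eqP; ring.
Qed.

Let nz p : p != 0 -> polyeval a b p != 0.
Proof. by apply: contra_neq; apply: ev_inj. Qed.

Lemma ratmorph_zmod_morphism : zmod_morphism ratmorph.
Proof.
move=> f g; have hf := fraction_mul_denom f; have hg := fraction_mul_denom g.
move: (denom_ratioP (repr f)) (denom_ratioP (repr g)) => d1 d2.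
rewrite (ratmorphE d1 hf) (ratmorphE d2 hg).
rewrite (ratmorphE (n := \n_(repr f) * \d_(repr g) - \d_(repr f) * \n_(repr g))
  (mulf_neq0 d1 d2)).
  rewrite rmorphB !rmorphM /=; apply/esym.
  by rewrite -[in LHS]mulNr addf_div ?nz // mulNr [X in _ - X]mulrC.
by rewrite rmorphB !rmorphM /= -hf -hg; ring.
Qed.

Lemma ratmorph_monoid_morphism : monoid_morphism ratmorph.
Proof.
split=> [|f g].
  by rewrite (ratmorphE (n := 1) (oner_neq0 _)) ?mul1r // divff // nz ?oner_neq0.
have hf := fraction_mul_denom f; have hg := fraction_mul_denom g.
move: (denom_ratioP (repr f)) (denom_ratioP (repr g)) => d1 d2.
rewrite (ratmorphE d1 hf) (ratmorphE d2 hg).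
rewrite (ratmorphE (n := \n_(repr f) * \n_(repr g)) (mulf_neq0 d1 d2)).
  by rewrite !rmorphM /= mulf_div.
by rewrite !rmorphM /= -hf -hg; ring.
Qed.

HB.instance Definition _ :=
  GRing.isZmodMorphism.Build K K ratmorph ratmorph_zmod_morphism.
HB.instance Definition _ :=
  GRing.isMonoidMorphism.Build K K ratmorph ratmorph_monoid_morphism.

Let ratmorph_tofrac p : ratmorph (tofrac p) = polyeval a b p.
Proof. by rewrite (ratmorphE (oner_neq0 _) (n := p)) !rmorph1 ?mulr1 ?divr1. Qed.

Lemma rateval_morphism : exists phi : {rmorphism K -> K},
  [/\ forall f, rateval f a b = phi f, phi X = a, phi Y = b
     & forall c, phi (cst c) = cst c].
Proof.
exists ratmorph; split=> [//|||c].
- exact: etrans (ratmorph_tofrac _) (polyevalX0 a b).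
- exact: etrans (ratmorph_tofrac _) (polyevalX1 a b).
exact: etrans (ratmorph_tofrac _) (polyevalC a b c).
Qed.

End Generic.

(* If the rational map (f / h, g / h) of the plane is onto, then no nonzero
   polynomial vanishes on it. *)
Lemma polyeval_inj a b (f g h : {mpoly C[2]}) :
    tofrac h * a = tofrac f -> tofrac h * b = tofrac g ->
    (forall c d, exists v, [/\ h.@[v] != 0, f.@[v] = c * h.@[v] & g.@[v] = d * h.@[v]]) ->
  forall p, polyeval a b p = 0 -> p = 0.
Proof.
move=> ha hb onto p ev0.
(* Clearing denominators: [P] is h^N p(f/h, g/h). *)
have [N [P [hP vP]]] : exists N P, tofrac h ^+ N * polyeval a b p = tofrac P /\
    forall v c d, f.@[v] = c * h.@[v] -> g.@[v] = d * h.@[v] ->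
      P.@[v] = h.@[v] ^+ N * p.@[fun k => if k == 0 then c else d].
  elim/mpolyind: {ev0} p => [|c m p _ _ [N [P [hP vP]]]].
    by exists 0%N, 0; split=> [|v c d _ _]; rewrite ?rmorph0 ?meval0 ?mulr0.
  exists (m 0%R + m 1%R + N)%N,
    (c *: (f ^+ m 0 * g ^+ m 1) * h ^+ N + h ^+ (m 0%R + m 1%R) * P).
  split=> [|v x y hx hy].
    rewrite !rmorphD /= mulrDr; congr (_ + _).
      rewrite /polyeval mmapZ mmapX /mmap1 big_ord2 /= -mul_mpolyC.
      rewrite !rmorphM /= !rmorphXn /=.
      by rewrite -ha -hb !exprMn !exprD /ratC; ring.
    by rewrite rmorphM rmorphXn /= -hP exprD mulrA.
  rewrite mevalD !mevalM mevalZ mevalM !rmorphXn /= (vP v x y) //.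
  rewrite mevalD mevalZ mevalX big_ord2 /=.
  by rewrite hx hy !exprMn !exprD; ring.
apply: mpoly2_zeros_eq0 => w.
have P0 : P = 0 by apply/eqP; rewrite -tofrac_eq0 -hP ev0 mulr0.
have [v [h0 hx hy]] := onto (w 0) (w 1).
have := vP v _ _ hx hy; rewrite P0 meval0 => /esym/eqP.
rewrite mulf_eq0 expf_eq0 (negbTE h0) andbF /= => /eqP E.
rewrite -[RHS]E; apply: meval_eq => k.
by case: k => [[|[|?]] ?] //=; congr w; apply: val_inj.
Qed.

End RatEvaluation.

(** * The HOMFLY-PT polynomial of 3-braids *)

Record hecke_functional (K : comRingType) (z : K) (F : braid3 -> K) : Prop :=
  HeckeFunctional {
  hecke_braid : braid_function F;
  hecke_skeinP : hecke_skein z F;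
  hecke_conj : forall x s, F (x ++ [:: s]) = F (s :: x)
}.

Lemma hecke_functional_lin (K : comRingType) (z : K) F G (b c : K) :
  hecke_functional z F -> hecke_functional z G ->
  hecke_functional z (fun x => b * F x + c * G x).
Proof.
move=> [[F2 F3] Fs Fc] [[G2 G3] Gs Gc]; split=> [|x y k|x s].
- by split=> x y k => [e|l e]; [rewrite F2 G2 | rewrite F3 G3].
- by rewrite opprD addrACA -!mulrBr Fs Gs mulrDr !(mulrCA z).
by rewrite Fc Gc.
Qed.

Lemma exponent_sum_R2 x y k e :
  exponent_sum (x ++ [:: (k, e); (k, ~~ e)] ++ y) = exponent_sum (x ++ y).
Proof.
rewrite !exponent_sum_cat !exponent_sum_cons {2}/exponent_sum big_nil.
by case: e => /=; ring.
Qed.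

Lemma exponent_sum_R3 x y k l e :
  exponent_sum (x ++ [:: (k, e); (l, e); (k, e)] ++ y)
    = exponent_sum (x ++ [:: (l, e); (k, e); (l, e)] ++ y).
Proof. by rewrite !exponent_sum_cat !exponent_sum_cons. Qed.

Lemma exponent_sum_conj x s : exponent_sum (x ++ [:: s]) = exponent_sum (s :: x).
Proof.
by rewrite exponent_sum_cat !exponent_sum_cons addrC -addrA /exponent_sum big_nil add0r.
Qed.

Lemma exponent_sum_split x y k e :
  exponent_sum (x ++ (k, e) :: y) = exponent_sum (x ++ y) + (if e then 1 else -1).
Proof. by rewrite !exponent_sum_cat exponent_sum_cons addrA addrAC. Qed.

Section Homflypt.
Variables (K : fieldType) (a z : K) (H : odiagram -> K).
Hypotheses (a_neq0 : a != 0) (z_neq0 : z != 0).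
Hypothesis hH : regular_invariant negb 1 H.
Hypothesis H_unknot : H [:: (Cup true, 0%N); (Cap, 0%N)] = 1.
Hypothesis H_skein : forall u v i w, olink (u ++ (Cross true, i) :: v) ->
  labels negb u = Some w -> nth true w i -> nth true w i.+1 ->
  a * H (u ++ (Cross true, i) :: v) - a^-1 * H (u ++ (Cross false, i) :: v)
    = z * H (u ++ v).

Local Notation C3 := (closure3 true).
Local Notation B := (braid_slices bool).

Lemma H_closure2_nil : H (closure2 true [::]) = (a - a^-1) / z.
Proof.
have := @H_skein [:: (Cup true, 0%N); (Cup true, 1%N)] [:: (Cap, 1%N); (Cap, 0%N)]
  0%N [:: true; true; false; false] erefl erefl isT isT.
have /= -> := markov_closure2 negbK hH true true.
have /= -> := markov_closure2 negbK hH true false.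
by rewrite H_unknot invr1 !mulr1 => ->; rewrite mulrC mulKf.
Qed.

Lemma H_closure3_nil : H (C3 [::]) = ((a - a^-1) / z) ^+ 2.
Proof.
have := @H_skein [:: (Cup true, 0%N); (Cup true, 1%N); (Cup true, 2%N)]
  [:: (Cap, 2%N); (Cap, 1%N); (Cap, 0%N)]
  1%N [:: true; true; true; false; false; false] erefl erefl isT isT.
have /= -> := markov_closure3 negbK hH true true.
have /= -> := markov_closure3 negbK hH true false.
rewrite H_closure2_nil invr1 !mul1r -mulrBl => E.
by apply: (mulfI z_neq0); rewrite -E; field; rewrite a_neq0 z_neq0.
Qed.

(** The factor a^w absorbs the coefficients of the skein relation, which becomes g - g^-1 = z. *)
Definition homflypt_part (x : braid3) : K := a ^ exponent_sum x * H (C3 (B x)).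

Lemma homflypt_partE x : H (C3 (B x)) = a ^ (- exponent_sum x) * homflypt_part x.
Proof. by rewrite /homflypt_part mulrA -expfzDr // addNr mul1r. Qed.

Lemma homflypt_part_functional : hecke_functional z homflypt_part.
Proof.
have [R2 R3] := braid_function_closure3 hH true.
split=> [|x y k|x s]; last first.
- by rewrite /homflypt_part exponent_sum_conj (closure3_conj hH).
- rewrite /homflypt_part !exponent_sum_split !expfzDr // expr1z exprN1.
  rewrite -!mulrA -mulrBr mulrCA.
  congr (_ * _); have link : olink (C3 (B (x ++ (k, true) :: y))).
    by apply: link_closure3; apply: run_braid_slices.
  have := @H_skein ([:: (Cup true, 0%N); (Cup true, 1%N); (Cup true, 2%N)] ++ B x)
    (B y ++ [:: (Cap, 2%N); (Cap, 1%N); (Cap, 0%N)]) k.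
  move: link; rewrite /closure3 !braid_slices_cat -!catA /= => link.
  by apply=> //; [exact: labels_cups_braid| |]; case: k {link} => [[|[|]]].
split=> x y k => [e|l e]; rewrite /homflypt_part.
  by rewrite exponent_sum_R2 R2.
by rewrite exponent_sum_R3 R3.
Qed.

Lemma homflypt_part_nil : homflypt_part [::] = ((a - a^-1) / z) ^+ 2.
Proof. by rewrite /homflypt_part /exponent_sum big_nil mul1r H_closure3_nil. Qed.

Lemma homflypt_part_gen1 : homflypt_part [:: (1, true)] = a * ((a - a^-1) / z).
Proof.
rewrite /homflypt_part /exponent_sum big_seq1 (markov_closure3 negbK hH).
by rewrite mul1r H_closure2_nil.
Qed.

Lemma homflypt_part_gen01 : homflypt_part [:: (0, true); (1, true)] = a ^+ 2.
Proof.
rewrite /homflypt_part /exponent_sum big_cons big_seq1 (markov_closure3_mul negbK hH).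
by rewrite (markov_closure2 negbK hH) H_unknot !mulr1.
Qed.

End Homflypt.

(** * Comparison of the two polynomials *)

Section SquareRootOfMinusOne.
Variables (K : fieldType) (j : K).
Hypothesis j2 : j * j = -1.

Lemma sqrtN1_neq0 : j != 0.
Proof. by apply: contra_eq_neq j2 => ->; rewrite mul0r eq_sym oppr_eq0 oner_eq0. Qed.

Lemma sqrtN1_inv : j^-1 = - j.
Proof. by apply: (mulfI sqrtN1_neq0); rewrite divff ?sqrtN1_neq0 // mulrN j2 opprK. Qed.

End SquareRootOfMinusOne.

Section Twist.
Variables (K : fieldType) (a z : K) (L : udiagram -> K).
Hypotheses (a_neq0 : a != 0) (z_neq0 : z != 0).
Hypothesis hL : regular_invariant (@id unit) a L.
Hypothesis L_unknot : L [:: (Cup tt, 0%N); (Cap, 0%N)] = 1.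
Hypothesis L_skein : forall u v i, ulink (u ++ (Cross true, i) :: v) ->
  L (u ++ (Cross true, i) :: v) + L (u ++ (Cross false, i) :: v)
    = z * (L (u ++ v) + L (u ++ hook i ++ v)).
Variables (phi : {rmorphism K -> K}) (j s : K).
Hypotheses (j2 : j * j = -1) (s2 : s * s = 1).
Hypothesis phi_a : phi a = s * j * a.
Hypothesis phi_z : phi z = j * z.

Let j_neq0 := sqrtN1_neq0 j2.
Let jV := sqrtN1_inv j2.

Let sV : s^-1 = s.
Proof.
have s_neq0 : s != 0 by apply: contra_eq_neq s2 => ->; rewrite mul0r eq_sym oner_eq0.
by apply: (mulfI s_neq0); rewrite divff // s2.
Qed.

(** [phi] turns g + g^-1 = z into g + g^-1 = j z; as j^-1 = -j, the factor j^-w makes this g - g^-1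
    = z. The sign [s] allows both substitutions to be treated together. *)
Definition twisted_part (x : braid3) : K :=
  j ^ (- exponent_sum x) * phi (hecke_part a z L x).

Lemma twisted_part_functional : hecke_functional z twisted_part.
Proof.
have hT := hecke_part_function z a_neq0 hL; split=> [|x y k|x l]; last first.
- by rewrite /twisted_part exponent_sum_conj hecke_part_conj.
- rewrite /twisted_part !exponent_sum_split !opprD opprK !expfzDr // expr1z exprN1 jV.
  have := congr1 phi (hecke_part_skein a_neq0 z_neq0 hL L_unknot L_skein x y k).
  by rewrite rmorphD rmorphM phi_z => /(canRL (addrK _)) ->; ring: j2.
split=> x y k => [e|l e]; rewrite /twisted_part.
  by rewrite exponent_sum_R2 (braid_R2 hT).
by rewrite exponent_sum_R3 (braid_R3 hT).
Qed.

Let d := (a - a^-1) / z.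

(** As j^-1 = -j, the sum a + a^-1 becomes a difference; [d] is the factor of a disjoint circle for
    H. *)
Let phi_loop : phi (loop_value a z) = s * d - 1.
Proof.
rewrite rmorphB rmorphM rmorphD !fmorphV rmorph1 phi_a phi_z; congr (_ - 1).
by rewrite !invfM jV sV /d; ring: j2.
Qed.

Lemma twisted_part_nil : twisted_part [::] = d ^+ 2 - 2 * s * d - 2.
Proof.
rewrite /twisted_part {1}/exponent_sum big_nil mul1r hecke_part_nil //.
by rewrite rmorphB rmorphXn /= phi_loop rmorph_nat; ring: s2.
Qed.

Lemma twisted_part_gen1 :
  twisted_part [:: (1, true)] = a * (d - s) - z + s * a^-1.
Proof.
rewrite /twisted_part {1}/exponent_sum big_seq1 exprN1 jV hecke_part_gen1 //.
rewrite rmorphB rmorphM phi_loop rmorphD fmorphV phi_a phi_z !invfM jV sV.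
by ring: j2 s2.
Qed.

Lemma twisted_part_gen01 : twisted_part [:: (0, true); (1, true)] = a ^+ 2.
Proof.
rewrite /twisted_part {1}/exponent_sum big_cons big_seq1 opprD expfzDr // exprN1 jV.
by rewrite hecke_part_gen01 // rmorphXn /= phi_a; ring: j2 s2.
Qed.

End Twist.

(** t, t' stand for the Hecke parts and c, c' for the characters. The relation is linear and the
    Hecke parts already account for h, so a nonzero multiple of the relation between c and c'
    remains. *)
Lemma relation_cancel (K : fieldType) (r u v h t c t' c' : K) :
  u != 0 -> v != 0 -> 2 != 0 :> K ->
  h = 2^-1 * (v * t + v * t') - r * (2^-1 * (v * t - v * t')) ->
  (u * h = 2^-1 * (v * u * (t + c) + v * u * (t' + c'))
     - r * (2^-1 * (v * u * (t + c) - v * u * (t' + c'))))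
  <-> 2^-1 * (c + c') = r * (2^-1 * (c - c')).
Proof.
move=> u0 v0 two0 ->.
have -> : 2^-1 * (v * u * (t + c) + v * u * (t' + c'))
     - r * (2^-1 * (v * u * (t + c) - v * u * (t' + c')))
   = u * (2^-1 * (v * t + v * t') - r * (2^-1 * (v * t - v * t')))
     + v * u * (2^-1 * (c + c') - r * (2^-1 * (c - c'))) by field.
split=> [/eqP|->]; last by rewrite subrr mulr0 addr0.
rewrite -subr_eq0 opprD addrA subrr sub0r oppr_eq0 mulf_eq0 mulf_eq0.
by rewrite (negbTE u0) (negbTE v0) subr_eq0 => /eqP.
Qed.

Section HomflyptKauffman.
Variables (K : fieldType) (a z : K) (H : odiagram -> K) (L : udiagram -> K).
Hypotheses (a_neq0 : a != 0) (z_neq0 : z != 0) (a2_neq1 : a - a^-1 != 0).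
Hypothesis two_neq0 : 2 != 0 :> K.
Hypothesis hH : regular_invariant negb 1 H.
Hypothesis H_unknot : H [:: (Cup true, 0%N); (Cap, 0%N)] = 1.
Hypothesis H_skein : forall u v i w, olink (u ++ (Cross true, i) :: v) ->
  labels negb u = Some w -> nth true w i -> nth true w i.+1 ->
  a * H (u ++ (Cross true, i) :: v) - a^-1 * H (u ++ (Cross false, i) :: v)
    = z * H (u ++ v).
Hypothesis hL : regular_invariant (@id unit) a L.
Hypothesis L_unknot : L [:: (Cup tt, 0%N); (Cap, 0%N)] = 1.
Hypothesis L_skein : forall u v i, ulink (u ++ (Cross true, i) :: v) ->
  L (u ++ (Cross true, i) :: v) + L (u ++ (Cross false, i) :: v)
    = z * (L (u ++ v) + L (u ++ hook i ++ v)).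
Variables (phi psi : {rmorphism K -> K}) (j : K).
Hypothesis j2 : j * j = -1.
Hypotheses (phi_a : phi a = j * a) (phi_z : phi z = j * z).
Hypotheses (psi_a : psi a = j * a) (psi_z : psi z = - (j * z)).

Lemma homflypt_twisted_part x :
  homflypt_part a H x
    = 2^-1 * (twisted_part a z L phi j x + twisted_part a z L psi (- j) x)
      - z / (a - a^-1)
        * (2^-1 * (twisted_part a z L phi j x - twisted_part a z L psi (- j) x)).
Proof.
have phi_a' : phi a = 1 * j * a by rewrite mul1r.
(* Sending a to ja and z to -jz is the twist by -j with s = -1. *)
have psi_a' : psi a = -1 * - j * a by rewrite mulrNN mul1r.
have psi_z' : psi z = - j * z by rewrite mulNr.
have j2' : - j * - j = -1 by rewrite mulrNN.
have s2 : 1 * 1 = 1 :> K by rewrite mulr1.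
have s2' : -1 * -1 = 1 :> K by rewrite mulrNN mulr1.
set r := z / (a - a^-1).
(* These weights add up to 1, and to -r when multiplied by s = 1, -1; so in the three values below s
   is in effect replaced by -r. *)
transitivity (2^-1 * (1 - r) * twisted_part a z L phi j x
    + 2^-1 * (1 + r) * twisted_part a z L psi (- j) x); last by ring.
have F_phi := twisted_part_functional a_neq0 z_neq0 hL L_unknot L_skein j2 phi_z.
have F_psi := twisted_part_functional a_neq0 z_neq0 hL L_unknot L_skein j2' psi_z'.
have [G2 Gs Gc] := hecke_functional_lin (2^-1 * (1 - r)) (2^-1 * (1 + r)) F_phi F_psi.
have [F2 Fs Fc] := homflypt_part_functional a_neq0 hH H_skein.
apply: (hecke_functional_unique _ F2 G2 Fs Gs Fc Gc).
- rewrite (homflypt_part_nil a_neq0 z_neq0 hH H_unknot H_skein).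
  rewrite (twisted_part_nil a_neq0 z_neq0 hL L_unknot L_skein j2 s2 phi_a' phi_z).
  rewrite (twisted_part_nil a_neq0 z_neq0 hL L_unknot L_skein j2' s2' psi_a' psi_z').
  have : r * ((a - a^-1) / z) = 1 by rewrite mulrA divfK // divff.
  by move: (_ / z) => d rd; field: rd.
- rewrite (homflypt_part_gen1 z_neq0 hH H_unknot H_skein).
  rewrite (twisted_part_gen1 z_neq0 hL L_unknot L_skein j2 s2 phi_a' phi_z).
  rewrite (twisted_part_gen1 z_neq0 hL L_unknot L_skein j2' s2' psi_a' psi_z').
  have rd : r * (a - a^-1) = z by rewrite divfK.
  by move: (_ / z) => d; rewrite -[in RHS]rd; move: a^-1 => b; field.
rewrite (homflypt_part_gen01 _ hH H_unknot).
rewrite (twisted_part_gen01 z hL L_unknot j2 s2 phi_a').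
by rewrite (twisted_part_gen01 z hL L_unknot j2' s2' psi_a'); field.
Qed.

Variable x : braid3.
Hypothesis even_x : (-1) ^ exponent_sum x = 1 :> K.

Local Notation kf :=
  (a ^ (- exponent_sum x) * L (closure3 tt (braid_slices unit x))).
Local Notation chi := (bmw_trace a z x).

Lemma homflypt_kauffman_trace :
  H (closure3 true (braid_slices bool x))
     = 2^-1 * (phi kf + psi kf) - z / (a - a^-1) * (2^-1 * (phi kf - psi kf))
  <-> 2^-1 * (phi chi + psi chi) = z / (a - a^-1) * (2^-1 * (phi chi - psi chi)).
Proof.
have j0 := sqrtN1_neq0 j2.
have kfE (f : {rmorphism K -> K}) : f a = j * a -> f kf
    = j ^ (- exponent_sum x) * a ^ (- exponent_sum x) * (f (hecke_part a z L x) + f chi).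
  move=> fa; rewrite -[L _](subrK chi) -/(hecke_part a z L x).
  by rewrite rmorphM rmorphD fmorphXz fa expfzMl.
rewrite (kfE phi) // (kfE psi) // (homflypt_partE _ a_neq0).
apply: relation_cancel; rewrite ?expfz_neq0 // homflypt_twisted_part /twisted_part.
(* [psi kf] carries j^-w but the twisted part for [psi] carries (-j)^-w; they agree because w is
   even. *)
have -> : (- j) ^ (- exponent_sum x) = j ^ (- exponent_sum x); last by [].
by rewrite -mulN1r expfzMl -invr_expz even_x invr1 mul1r.
Qed.

Variables (theta : {rmorphism K -> K}).
Hypotheses (theta_a : theta a = a) (theta_z : theta z = z - z^-1) (theta_j : theta j = j).

(** As b^-1 = -b, the element b (q - 1/q) equals beta + beta^-1 for beta = b q, which is the
    parameter of [rho0]. *)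
Lemma theta_trace (f : {rmorphism K -> K}) b : f a = j * a -> f z = b * z ->
  b * b = -1 -> theta b = b -> theta (f chi) = chi0 (j * a) (b * z) x.
Proof.
move=> fa fz b2 tb; have j0 := sqrtN1_neq0 j2.
rewrite !rmorph_bmw_trace ?fa ?mulf_neq0 // fz !rmorphM theta_j theta_a tb theta_z.
have -> : b * (z - z^-1) = b * z + (b * z)^-1.
  by rewrite invfM (sqrtN1_inv b2); ring.
by [].
Qed.

Lemma homflypt_kauffman_character :
  H (closure3 true (braid_slices bool x))
     = 2^-1 * (phi kf + psi kf) - z / (a - a^-1) * (2^-1 * (phi kf - psi kf))
  <-> 2^-1 * (chi0 (j * a) (j * z) x - chi0 (j * a) (- (j * z)) x)
     = (a - a^-1) / (z - z^-1)
       * (2^-1 * (chi0 (j * a) (j * z) x + chi0 (j * a) (- (j * z)) x)).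
Proof.
apply: (iff_trans homflypt_kauffman_trace).
have psi_z' : psi z = - j * z by rewrite mulNr.
have j2' : - j * - j = -1 by rewrite mulrNN.
have theta_Nj : theta (- j) = - j by rewrite rmorphN theta_j.
rewrite -mulNr -(theta_trace phi_a phi_z j2 theta_j).
rewrite -(theta_trace psi_a psi_z' j2' theta_Nj).
have zV0 : z - z^-1 != 0 by rewrite -theta_z fmorph_eq0.
have <- : theta (2^-1 * (phi chi + psi chi))
    = 2^-1 * (theta (phi chi) + theta (psi chi)).
  by rewrite rmorphM rmorphD fmorphV rmorph_nat.
have <- : theta (2^-1 * (phi chi - psi chi))
    = 2^-1 * (theta (phi chi) - theta (psi chi)).
  by rewrite rmorphM rmorphB fmorphV rmorph_nat.
move: (2^-1 * _) (2^-1 * _) => even odd; split=> [->|E].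
  rewrite !rmorphM fmorphV rmorphB fmorphV theta_z theta_a.
  by rewrite mulrA mulrA divfK // divff // mul1r.
(* A field morphism is injective, so the relation may be checked after the substitution. *)
apply: (fmorph_inj theta); rewrite !rmorphM fmorphV rmorphB fmorphV theta_z theta_a E.
by rewrite mulrA mulrA divfK // divff // mul1r.
Qed.

End HomflyptKauffman.

(** * Specialisation to the field of rational functions *)

Lemma regular_invariant_homflypt (C : numClosedFieldType) (H : odiagram -> ratfun C) :
  is_homflypt H -> regular_invariant negb 1 H.
Proof.
move=> hH; split=> [|u l r v s hc h1 h2]; first exact: (homflypt_regular hH).
by rewrite (homflypt_curl hH hc h1 h2) invr1 if_same mul1r.
Qed.

Lemma regular_invariant_kauffman (C : numClosedFieldType) (L : udiagram -> ratfun C) :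
  is_kauffman L -> regular_invariant (@id unit) (ratX C) L.
Proof.
by move=> hL; split; [exact: (kauffman_regular hL)|exact: (kauffman_curl hL)].
Qed.

(** For two upward strands the crossing sign is the exponent and the oriented smoothing adds no
    slice. *)
Lemma homflypt_skein_upward (C : numClosedFieldType) (H : odiagram -> ratfun C) :
  is_homflypt H -> forall u v i w, olink (u ++ (Cross true, i) :: v) ->
  labels negb u = Some w -> nth true w i -> nth true w i.+1 ->
  ratX C * H (u ++ (Cross true, i) :: v) - (ratX C)^-1 * H (u ++ (Cross false, i) :: v)
    = ratY C * H (u ++ v).
Proof.
move=> hH u v i w hl hw a b.
have := homflypt_skein hH hl hw; rewrite /crossing_sign /oriented_smoothing.
by move: a b; do 2!move=> /= ->; apply.
Qed.

Lemma forget_braid_closure x :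
  forget (braid_closure x) = closure3 tt (braid_slices unit x).
Proof. by rewrite /forget /closure3 /= map_cat -map_comp. Qed.

Section RationalTwists.
Variable C : numClosedFieldType.
Local Notation K := (ratfun C).
Local Notation X := (ratX C).
Local Notation Y := (ratY C).
Local Notation cst := (@ratC C).
Local Notation im := (cst 'i).

Lemma meval_neq0 (p : {mpoly C[2]}) v : p.@[v] != 0 -> p != 0.
Proof. by apply: contra_neq => ->; apply: meval0. Qed.

Lemma ratX_neq0 : X != 0.
Proof. by rewrite tofrac_eq0 (@meval_neq0 _ (fun=> 1)) // mevalXU oner_neq0. Qed.

Lemma ratY_neq0 : Y != 0.
Proof. by rewrite tofrac_eq0 (@meval_neq0 _ (fun=> 1)) // mevalXU oner_neq0. Qed.

Lemma rat2_neq0 : 2 != 0 :> K.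
Proof. by rewrite -(rmorph_nat cst) fmorph_eq0 pnatr_eq0. Qed.

Lemma ratX_subV_neq0 : X - X^-1 != 0.
Proof.
have h : 'X_0 * 'X_0 - 1 != 0 :> {mpoly C[2]}.
  apply: (@meval_neq0 _ (fun=> 0)).
  by rewrite mevalB mevalM meval1 mevalXU mulr0 sub0r oppr_eq0 oner_neq0.
apply: contraNneq h => /(congr1 ( *%R X)); rewrite mulrBr divff ?ratX_neq0 // mulr0.
by move=> E; rewrite -tofrac_eq0 rmorphB rmorphM rmorph1; apply/eqP.
Qed.

Lemma im_sqr : im * im = -1.
Proof. by rewrite -rmorphM -expr2 sqrCi rmorphN rmorph1. Qed.

Lemma twist_morphism (e : C) : e != 0 -> exists phi : {rmorphism K -> K},
  [/\ forall f, rateval f (im * X) (cst e * Y) = phi f, phi X = im * X,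
      phi Y = cst e * Y & forall c, phi (cst c) = cst c].
Proof.
move=> e0; apply: rateval_morphism.
apply: (polyeval_inj (h := 1) (f := 'i%:MP * 'X_0) (g := e%:MP * 'X_1)).
- by rewrite rmorph1 mul1r rmorphM.
- by rewrite rmorph1 mul1r rmorphM.
move=> c d; exists (fun k => if k == 0 then c / 'i else d / e).
rewrite meval1 !mevalM !mevalC !mevalXU /= !mulr1 oner_neq0.
by split=> //; rewrite mulrC divfK ?neq0Ci.
Qed.

(* The change of variables z = q - 1/q. *)
Lemma quantum_morphism : exists psi : {rmorphism K -> K},
  [/\ psi X = X, psi Y = Y - Y^-1 & forall c, psi (cst c) = cst c].
Proof.
have [psi [_ hX hY hC]] : exists psi : {rmorphism K -> K},
  [/\ forall f, rateval f X (Y - Y^-1) = psi f, psi X = X, psi Y = Y - Y^-1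
    & forall c, psi (cst c) = cst c]; last by exists psi.
apply: rateval_morphism.
apply: (polyeval_inj (h := 'X_1) (f := 'X_0 * 'X_1) (g := 'X_1 * 'X_1 - 1)).
- by rewrite rmorphM mulrC.
- by rewrite rmorphB rmorphM rmorph1 mulrBr divff // ratY_neq0.
(* [t] solves t - 1/t = d: it is a root of t^2 - d t - 1, and nonzero because of the constant
   term. *)
move=> c d; pose s := sqrtC (d ^+ 2 + 4%:R); pose t := (d + s) / 2.
have ht : t * t - 1 = d * t.
  have hs : s * s = d * d + 4%:R by rewrite -expr2 sqrtCK expr2.
  by rewrite /t; field: hs.
exists (fun k => if k == 0 then c else t).
rewrite mevalB !mevalM meval1 !mevalXU /=; split=> //.
apply: contra_eq_neq ht => ->; rewrite !mulr0 sub0r oppr_eq0.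
exact: oner_neq0.
Qed.

End RationalTwists.

Theorem proposition4p1 (C : numClosedFieldType)
    (H : odiagram -> ratfun C) (L : udiagram -> ratfun C)
    (hH : is_homflypt H) (hL : is_kauffman L)
    (x : braid3) (hx : is_knot (braid_closure x)) :
  (let A := ratX C in
   let z := ratY C in
   H (braid_closure x)
     = KF_even L (braid_closure x)
       - z / (A - A^-1) * KF_odd L (braid_closure x))
  <->
  (let A := ratX C in
   let q := ratY C in
   chi0_odd C x = (A - A^-1) / (q - q^-1) * chi0_even C x).
Proof.
move=> /=.
have X0 := ratX_neq0 C; have Y0 := ratY_neq0 C.
have XV0 := ratX_subV_neq0 C; have two0 := rat2_neq0 C; have i2 := im_sqr C.
(* [phi] and [phi'] are the evaluations at (iA, iz) and (iA, -iz); [psi] substitutes q - 1/q for z,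
   with q again the second variable. *)
have [phi [evphi phiX phiY _]] := twist_morphism (neq0Ci C).
have Ni0 : - 'i != 0 :> C by rewrite oppr_eq0 neq0Ci.
have [phi' [evphi' phiX' phiY' _]] := twist_morphism Ni0.
have [psi [psiX psiY psiC]] := quantum_morphism C.
move: evphi' phiY'; rewrite rmorphN mulNr => evphi' phiY'.
have key := homflypt_kauffman_character X0 Y0 XV0 two0
  (regular_invariant_homflypt hH) (homflypt_unknot hH true) (homflypt_skein_upward hH)
  (regular_invariant_kauffman hL) (kauffman_unknot hL) (kauffman_skein hL)
  i2 phiX phiY phiX' phiY' (signr_knot _ hx) psiX psiY (psiC _).
rewrite /KF_even /KF_odd !evphi !evphi' /KF writhe_braid_closure forget_braid_closure.
exact: key.
Qed.
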